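(* Let $\Sigma$ be a finite alphabet, let $\Sigma_A^+\subseteq\Sigma^{\mathbb N}$ be a topologically mixing (one-sided) shift of finite type, let $\varphi:\Sigma_A^+\to\mathbb R$ be a potential with Gibbs measure $\mu_\varphi$, and let $\pi:\Sigma_A^+\to Y=\pi(\Sigma_A^+)\subseteq\overline{\Sigma}^{\mathbb N}$ be a fiber-wise sub-positive mixing single site factor map. If $\varphi$ is Bowen (respectively Walters, Hölder), then $\pi_*\mu_\varphi$ is the Gibbs state for a potential $\psi:Y\to\mathbb R$ which is Bowen (respectively Walters, Hölder).
   Context: Shift of finite type: $A$ is a $0$-$1$ matrix indexed by $\Sigma$, and $\Sigma_A^+=\{(x_i)_{i\ge0}\in\Sigma^{\mathbb N}: A_{x_ix_{i+1}}=1\ \forall i\}$, with the left shift $T$. A word is admissible in a subshift if it occurs in some point of it; $[w_0\cdots w_{n}]$ denotes the cylinder set of points beginning with $w_0\cdots w_n$. Single site factor map: given a map $\pi:\Sigma\to\overline\Sigma$ of finite alphabets, the induced map is $\pi((x_i)_{i\ge0})=(\pi(x_i))_{i\ge0}$; $Y$ is the image of $\Sigma_A^+$; $\pi$ is applied letter by letter to words. $\pi_*\mu(E)=\mu(\pi^{-1}E)$. Fiber-wise sub-positive mixing: there exists $N$ such that for any word $b_0\cdots b_N$ admissible in $Y$ and any words $u_0\cdots u_N$, $w_0\cdots w_N$ admissible in $\Sigma_A^+$ with $\pi(u_0\cdots u_N)=\pi(w_0\cdots w_N)=b_0\cdots b_N$, there is a word $a_0\cdots a_N$ admissible in $\Sigma_A^+$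 with $\pi(a_0\cdots a_N)=b_0\cdots b_N$, $a_0=u_0$ and $a_N=w_N$. Regularity classes: let $X$ be $\Sigma_A^+$ or $Y$ and $\varphi:X\to\mathbb R$. Put $\operatorname{var}_n\varphi=\sup\{|\varphi(x)-\varphi(y)|:x_i=y_i,\ 0\le i\le n-1\}$ and $S_n\varphi(x)=\sum_{i=0}^{n-1}\varphi(T^ix)$. - $\varphi$ is Hölder if there are a constant $|\varphi|_\theta$ and $0<\theta<1$ with $\operatorname{var}_n\varphi\le|\varphi|_\theta\theta^n$ for all $n\ge0$. - $\varphi$ is Walters if $\sup_{n\ge1}\operatorname{var}_{n+k}S_n\varphi\to0$ as $k\to\infty$. - $\varphi$ is Bowen if $\varphi$ is continuous and there is a constant $K$ with $\sup_{n\ge1}\operatorname{var}_nS_n\varphi\le K$. Gibbs measure (Gibbs state): a shift-invariant Borel probability measure $\mu$ on $X$ is the Gibbs measure for $\varphi$ if there are constants $C>0$ and $P$ such that $C^{-1}\le \mu([x_0\cdots x_{n-1}])/e^{-nP+S_n\varphi(x)}\le C$ for all $x\in X$, $n>0$. (For Bowen $\varphi$ on a topologically mixing shift of finite type such a measure exists and is unique.) *)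

(* Defs.v *)
From HB Require Import structures.
From mathcomp Require Import all_boot all_order all_algebra.
From mathcomp Require Import all_classical all_reals all_analysis.

Set Implicit Arguments.
Unset Strict Implicit.
Unset Printing Implicit Defensive.

Import Order.TTheory GRing.Theory Num.Theory.
Import numFieldNormedType.Exports.

Local Open Scope classical_set_scope.
Local Open Scope ring_scope.

(* A finite alphabet.  The point only records that the alphabet is nonempty; it
   is there because [measurableType] inherits from [pointedType]. *)
#[short(type="finPointedType")]
HB.structure Definition FinPointed := {T of Finite T & Pointed T}.

(* The sequences S^N, with the product of the discrete topologies and the Borel
   sigma-algebra. *)
Definition fullshift (S : finPointedType) : Type := nat -> S.

HB.instance Definition _ (S : finPointedType) :=
  Topological.copy (fullshift S)
    (prod_topology (fun _ : nat => discrete_topology S)).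

HB.instance Definition _ (S : finPointedType) :=
  isPointed.Build (fullshift S) (fun=> point).

Definition borel_display (S : finPointedType) : measure_display :=
  sigma_display (@open (fullshift S)).

HB.instance Definition _ (S : finPointedType) :=
  @isMeasurable.Build (borel_display S) (fullshift S)
    <<s @open (fullshift S) >>
    (@sigma_algebra0 _ setT (@open (fullshift S)))
    (@sigma_algebraC _ (@open (fullshift S)))
    (@sigma_algebra_bigcup _ setT (@open (fullshift S))).

(* A subshift X over S is a subset of S^N.  A potential X -> R is a total
   function on S^N of which only the values on X matter, and a Borel probability
   measure on X is a Borel probability measure on S^N giving mass 1 to X. *)

Definition shift (S : finPointedType) (x : fullshift S) : fullshift S :=
  fun i => x i.+1.

Definition sft (S : finPointedType) (A : rel S) : set (fullshift S) :=
  [set x | forall i, A (x i) (x i.+1)].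

Definition topologically_mixing (S : finPointedType) (X : set (fullshift S)) :=
  forall U V : set (fullshift S), open U -> open V ->
    X `&` U !=set0 -> X `&` V !=set0 ->
    exists N : nat, forall n, (N <= n)%N ->
      X `&` U `&` (iter n (@shift S)) @^-1` (X `&` V) !=set0.

Definition cylinder (S : finPointedType) (X : set (fullshift S)) (w : seq S) :
    set (fullshift S) :=
  [set x | X x /\ mkseq x (size w) = w].

Definition admissible (S : finPointedType) (X : set (fullshift S)) (w : seq S) :=
  exists x : fullshift S, exists i : nat,
    X x /\ mkseq (iter i (@shift S) x) (size w) = w.

Definition site_map (S S' : finPointedType) (f : S -> S') (x : fullshift S) :
    fullshift S' :=
  fun i => f (x i).

Lemma continuous_site_map (S S' : finPointedType) (f : S -> S') :
  continuous (site_map f).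
Proof.
move=> x; have Ff : Filter (site_map f @ x).
  by apply: fmap_filter; apply: nbhs_filter.
apply/(cvg_sup _ (site_map f x)) => i U [V [[W oW <-]] Wfx WU].
have cpi : {for x,
    continuous (fun y : fullshift S => y i : discrete_topology S)}.
  exact: (@proj_continuous nat (fun=> discrete_topology S) i x).
have nx : nbhs x [set y : fullshift S | y i = x i].
  exact: cpi (discrete_set1 (x i : discrete_topology S)).
suff : nbhs x (site_map f @^-1` U) by [].
move: nx; apply: filterS => y /= yi.
by apply: WU; move: Wfx; rewrite /site_map /= yi.
Qed.

Lemma measurable_site_map (S S' : finPointedType) (f : S -> S') :
  measurable_fun setT (site_map f).
Proof.
apply: (@measurability _ _ _ _ setT (site_map f) (@open (fullshift S'))) => //.
move=> _ [B oB <-]; rewrite setTI; apply: sub_sigma_algebra.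
by have /continuousP := @continuous_site_map _ _ f; exact.
Qed.

HB.instance Definition _ (S S' : finPointedType) (f : S -> S') :=
  isMeasurableFun.Build _ _ _ _ (site_map f) (measurable_site_map f).

Definition fiberwise_subpositive_mixing (S S' : finPointedType)
    (X : set (fullshift S)) (f : S -> S') :=
  exists N : nat,
    forall (b : N.+1.-tuple S') (u w : N.+1.-tuple S),
      admissible (site_map f @` X) b ->
      admissible X u -> admissible X w ->
      map f u = b -> map f w = b ->
      exists a : N.+1.-tuple S,
        [/\ admissible X a, map f a = b,
            tnth a ord0 = tnth u ord0 & tnth a ord_max = tnth w ord_max].

Section regularity.
Context {R : realType} {S : finPointedType}.
Implicit Types (X : set (fullshift S)) (phi : fullshift S -> R).

Definition var X (n : nat) phi : \bar R :=
  ereal_sup [set (`|phi p.1 - phi p.2|)%:E | p in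
    [set p : fullshift S * fullshift S |
      [/\ X p.1, X p.2 & forall i, (i < n)%N -> p.1 i = p.2 i]]].

Definition birkhoff_sum (n : nat) phi : fullshift S -> R :=
  fun x => \sum_(0 <= i < n) phi (iter i (@shift S) x).

Definition is_holder X phi :=
  exists c theta : R, 0 < theta < 1 /\
    forall n, (var X n phi <= (c * theta ^+ n)%:E)%E.

Definition is_walters X phi :=
  (fun k => ereal_sup [set var X (n + k)%N (birkhoff_sum n phi) |
                        n in [set n | (1 <= n)%N]]) @ \oo --> 0%E.

Definition is_bowen X phi :=
  {within X, continuous phi} /\
  exists K : R,
    (ereal_sup [set var X n (birkhoff_sum n phi) |
                 n in [set n | (1 <= n)%N]] <= K%:E)%E.

Definition shift_invariant (mu : probability (fullshift S) R) :=
  forall E, measurable E -> mu (@shift S @^-1` E) = mu E.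

Definition is_gibbs X phi (mu : probability (fullshift S) R) :=
  [/\ mu X = 1%E, shift_invariant mu &
      exists C P : R, 0 < C /\
        forall x n, X x -> (0 < n)%N ->
          ((C^-1)%:E <=
           mu (cylinder X (mkseq x n)) /
             (expR (- (n%:R * P) + birkhoff_sum n phi x))%:E <=
           C%:E)%E].

End regularity.

(* Main.v *)
Require Import Defs.
From mathcomp Require Import all_boot all_order all_algebra.
From mathcomp Require Import all_classical all_reals all_analysis.
From mathcomp Require Import ring lra.
Import Order.TTheory GRing.Theory Num.Theory.
(* [Defs] is imported again so that [shift] denotes the shift map. *)
Import numFieldNormedType.Exports Defs.
Local Open Scope classical_set_scope.
Local Open Scope ring_scope.

(* For a word u over the factor alphabet let L_u f(x) be the sum of
   e^(S_n phi(ax)) f(ax) over the words a above u for which ax is a point, and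
   let Z(u) be the sum of L_u 1 over finitely many reference points, one for
   each first letter.  The Gibbs property gives pi_* mu [u] ~ e^(-nP) Z(u) up to
   a constant, so a potential psi is wanted with S_n psi(y) = ln Z(y_0..y_(n-1))
   + O(1).  It is
     psi(y) = lim_m ln (Z(y_0..y_m) / Z(y_1..y_m)),
   for which telescoping gives
     S_n psi(y) = lim_m ln (Z(y_0..y_(n+m-1)) / Z(y_n..y_(n+m-1))).
   Since L_(uv) = L_v L_u, the ratio Z(uv)/Z(v) is an average of the function
   L_v(L_u 1)/L_v 1, and everything reduces to the decay, as v grows, of the
   oscillation of such quotients L_v g/L_v h.

   Sub-positive mixing makes the oscillation contract: over a window of N+1
   letters the words above the window can be exchanged freely, so the value of
   L_v g/L_v h at one point controls its values at all points, up to the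
   variation of g/h over points with a long common prefix (osc_step).  That
   variation is itself controlled by the regularity of phi (var_step).  For
   Bowen phi the oscillation tends to 0 for each fixed u, which makes psi
   continuous; for Walters phi it does so uniformly in u; for Hoelder phi
   oscillation and variation decay together geometrically. *)

Set Implicit Arguments.
Unset Strict Implicit.
Unset Printing Implicit Defensive.

(** * Words and prefixes *)

Section words.
Context {S : finPointedType}.
Implicit Types (x : fullshift S) (a : seq S).

Definition scons (s : S) x : fullshift S := fun i => if i is j.+1 then x j else s.

Definition wcons a x : fullshift S := foldr scons x a.

Definition agree k x x' := forall i, (i < k)%N -> x i = x' i.

Lemma wcons_rcons a s x : wcons (rcons a s) x = wcons a (scons s x).
Proof. exact: foldr_rcons. Qed.

Lemma wcons_cat a b x : wcons (a ++ b) x = wcons a (wcons b x).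
Proof. exact: foldr_cat. Qed.

Lemma scons_head x : scons (x 0%N) (@shift S x) = x.
Proof. by apply/funext; case. Qed.

Lemma iter_shiftE n x i : iter n (@shift S) x i = x (n + i)%N.
Proof. by elim: n i => //= n IH i; rewrite /shift IH addnS. Qed.

Lemma iter_shift_wcons a x : iter (size a) (@shift S) (wcons a x) = x.
Proof. by elim: a => //= s a IH; rewrite -iterS iterSr. Qed.

Lemma wcons_nth a x i : wcons a x i =
  if (i < size a)%N then nth (x 0%N) a i else x (i - size a)%N.
Proof.
elim: a i => [|s a IH] i /=; first by rewrite subn0.
by case: i => //= i; rewrite IH ltnS.
Qed.

Lemma wcons_mkseq n x : wcons (mkseq x n) (iter n (@shift S) x) = x.
Proof.
apply/funext => i; rewrite wcons_nth size_mkseq.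
case: ltnP => ni; first by rewrite nth_mkseq.
by rewrite iter_shiftE subnKC.
Qed.

Lemma mkseq_wcons a x : mkseq (wcons a x) (size a) = a.
Proof.
apply: (@eq_from_nth _ (x 0%N)); rewrite size_mkseq // => i i_lt.
by rewrite nth_mkseq // wcons_nth i_lt.
Qed.

Lemma agree_wcons k a x x' : agree k x x' -> agree (size a + k) (wcons a x) (wcons a x').
Proof.
by elim: a => [//|s a IH] xx' [//|i] /=; rewrite ltnS => /IH; apply.
Qed.

Lemma agree_sym k x x' : agree k x x' -> agree k x' x.
Proof. by move=> xx' i /xx' ->. Qed.

Lemma agree_leq m k x x' : (m <= k)%N -> agree k x x' -> agree m x x'.
Proof. by move=> mk xx' i im; apply: xx'; apply: leq_trans mk. Qed.

Lemma agree_iter n k x x' :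
  agree (n + k) x x' -> agree k (iter n (@shift S) x) (iter n (@shift S) x').
Proof. by move=> xx' i ik; rewrite !iter_shiftE xx' ?ltn_add2l. Qed.

Lemma agree_mkseq k x x' : agree k x x' <-> mkseq x k = mkseq x' k.
Proof.
split=> [xx'|E i ik]; last by move: (congr1 (nth (x 0%N) ^~ i) E); rewrite !nth_mkseq.
by apply/eq_in_map => i; rewrite mem_iota /= add0n; apply: xx'.
Qed.

Lemma mkseq_addn n m x : mkseq x (n + m) = mkseq x n ++ mkseq (iter n (@shift S) x) m.
Proof.
rewrite /mkseq iotaD map_cat; congr (_ ++ _);
  rewrite add0n -[n in iota n m]addn0 iotaDl -map_comp.
by apply: eq_map => i /=; rewrite iter_shiftE.
Qed.

Lemma sft_scons (A : rel S) s x : sft A (scons s x) <-> A s (x 0%N) /\ sft A x.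
Proof.
split=> [H|[H0 H]]; last by move=> i; case: i => [|i]; [exact: H0|exact: (H i)].
by split; [exact: (H 0%N)|move=> i; exact: (H i.+1)].
Qed.

Lemma sft_iter (A : rel S) n x : sft A x -> sft A (iter n (@shift S) x).
Proof. by move=> Xx i; rewrite !iter_shiftE addnS. Qed.

(** The transition rule relates adjacent letters only, so past the junction the tail can be replaced
    by any point with the same first letter. *)
Lemma sft_wcons_eq (A : rel S) a x x' :
  x 0%N = x' 0%N -> sft A x' -> sft A (wcons a x) -> sft A (wcons a x').
Proof.
move=> x0 Xx'; elim: a => [//|s a IH] /= /sft_scons[As /IH Xa].
by apply/sft_scons; split=> //; case: a As {IH Xa} => //=; rewrite x0.
Qed.

Lemma sft_wcons_last (A : rel S) a b s x y :
  sft A (wcons (rcons a s) y) -> sft A (wcons (rcons b s) x) -> sft A (wcons (rcons a s) x).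
Proof.
rewrite !wcons_rcons => Ha Hb; apply: sft_wcons_eq Ha => //.
by have := sft_iter (size b) Hb; rewrite iter_shift_wcons.
Qed.

End words.

Lemma map_mkseq (S S' : finPointedType) (f : S -> S') (x : fullshift S) n :
  map f (mkseq x n) = mkseq (site_map f x) n.
Proof. by rewrite /mkseq -map_comp. Qed.

Lemma iter_shift_site_map (S S' : finPointedType) (f : S -> S') n (x : fullshift S) :
  iter n (@shift S') (site_map f x) = site_map f (iter n (@shift S) x).
Proof. by apply/funext => i; rewrite iter_shiftE /site_map iter_shiftE. Qed.

(** * Birkhoff sums: the cocycle identity and a uniform bound *)

Section birkhoff.
Context {R : realType} {S : finPointedType}.
Implicit Types (x : fullshift S) (phi : fullshift S -> R).

Lemma birkhoff_sum0 phi x : birkhoff_sum 0 phi x = 0.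
Proof. by rewrite /birkhoff_sum big_geq. Qed.

Lemma birkhoff_sumD n m phi x :
  birkhoff_sum (n + m) phi x = birkhoff_sum n phi x + birkhoff_sum m phi (iter n (@shift S) x).
Proof.
rewrite /birkhoff_sum (@big_cat_nat _ _ _ n) ?leq_addr //=; congr (_ + _).
rewrite -{1}[n]add0n big_addn addKn; apply: eq_bigr => i _.
by rewrite iterD.
Qed.

Lemma birkhoff_sum1 phi x : birkhoff_sum 1 phi x = phi x.
Proof. by rewrite /birkhoff_sum big_nat1. Qed.

Lemma birkhoff_sumS n phi x : birkhoff_sum n.+1 phi x = phi x + birkhoff_sum n phi (@shift S x).
Proof. by rewrite -add1n birkhoff_sumD birkhoff_sum1. Qed.

Lemma birkhoff_sum_rcons phi a s x :
  birkhoff_sum (size a).+1 phi (wcons a (scons s x)) =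
  birkhoff_sum (size a) phi (wcons a (scons s x)) + phi (scons s x).
Proof. by rewrite -addn1 birkhoff_sumD birkhoff_sum1 iter_shift_wcons. Qed.

Lemma birkhoff_sum_le (X : set (fullshift S)) phi (M : R) n x :
  (forall x, X x -> X (@shift S x)) -> (forall x, X x -> `|phi x| <= M) -> X x ->
  `|birkhoff_sum n phi x| <= n%:R * M.
Proof.
move=> XT HM; elim: n x => [|n IH] x Xx; first by rewrite birkhoff_sum0 normr0 mul0r.
rewrite birkhoff_sumS (le_trans (ler_normD _ _))// -add1n natrD mulrDl mul1r lerD ?HM//.
by apply: IH; apply: XT.
Qed.

End birkhoff.

(** * Fibre transfer operators *)

Section operators.
Context {R : realType} {S S' : finPointedType}.
Variables (A : rel S) (pi : S -> S') (phi : fullshift S -> R).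
Implicit Types (x : fullshift S) (a : seq S) (u v : seq S') (f g h : fullshift S -> R).

Local Notation X := (sft A).

(** The Ruelle transfer operator of [phi], restricted to preimages whose new first letter lies above
    [s]. For [X x], the condition [A t (x 0%N)] says that [scons t x] is again a point. *)
Definition Lop (s : S') f : fullshift S -> R := fun x =>
  \sum_(t | (pi t == s) && A t (x 0%N)) expR (phi (scons t x)) * f (scons t x).

(** Letters act from left to right, so the last letter of [u] stands directly before the point and
    the summed words read in the order of [u]. *)
Definition Lw u f := foldl (fun g s => Lop s g) f u.

Lemma Lw_rcons u s f : Lw (rcons u s) f = Lop s (Lw u f).
Proof. exact: foldl_rcons. Qed.

Lemma Lw_cat u v f : Lw (u ++ v) f = Lw v (Lw u f).
Proof. exact: foldl_cat. Qed.

(** Points with a common first letter have the same words before them, so values can be compared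
    word by word. Induction on [u] does this without expanding the operator into a sum over
    words. *)
Lemma Lw_le u f f' c x x' : x 0%N = x' 0%N -> X x ->
  (forall a, map pi a = u -> X (wcons a x) ->
    expR (birkhoff_sum (size u) phi (wcons a x)) * f (wcons a x) <=
    c * (expR (birkhoff_sum (size u) phi (wcons a x')) * f' (wcons a x'))) ->
  Lw u f x <= c * Lw u f' x'.
Proof.
elim/last_ind: u c x x' => [|u s IH] c x x' x0 Xx H.
  by have := H [::] erefl Xx; rewrite /= !birkhoff_sum0 expR0 !mul1r.
rewrite !Lw_rcons /Lop mulr_sumr x0; apply: ler_sum => t /andP[/eqP ts At].
have Xt : X (scons t x) by apply/sft_scons; rewrite x0.
set e := expR (phi (scons t x)); set e' := expR (phi (scons t x')).
have e0 : 0 < e by exact: expR_gt0.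
(* The weights of [t] at the two points go into the constant: the induction hypothesis is used with
   [c * e' / e]. *)
have e'E : c * (e' * Lw u f' (scons t x')) = e * (c * e' / e * Lw u f' (scons t x')).
  by field; rewrite gt_eqF.
rewrite e'E ler_pM2l//.
apply: IH => // a au Xa.
have := H (rcons a t); rewrite !wcons_rcons map_rcons au ts size_rcons.
have su : size u = size a by rewrite -au size_map.
rewrite su !birkhoff_sum_rcons -su => /(_ erefl Xa).
rewrite !expRD -/e -/e' => le1.
rewrite -(ler_pM2r e0).
have -> : forall b d, c * e' / e * (b * d) * e = c * (b * e' * d) by move=> b d; field;
  rewrite gt_eqF.
by rewrite mulrAC.
Qed.

Lemma Lw_mono u f g x : X x -> (forall x, X x -> f x <= g x) -> Lw u f x <= Lw u g x.
Proof.
move=> Xx fg; rewrite -[leRHS]mul1r; apply: Lw_le => // a _ Xa.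
by rewrite mul1r ler_pM2l ?expR_gt0// fg.
Qed.

Lemma Lw_lin u f g c x : Lw u (fun x => f x + c * g x) x = Lw u f x + c * Lw u g x.
Proof.
elim/last_ind: u x => [//|u s IH] x; rewrite !Lw_rcons /Lop mulr_sumr -big_split /=.
by apply: eq_bigr => t _; rewrite IH; ring.
Qed.

Lemma Lw0 u x : Lw u (fun=> 0) x = 0.
Proof.
elim/last_ind: u x => [//|u s IH] x; rewrite Lw_rcons /Lop.
by apply: big1 => t _; rewrite IH mulr0.
Qed.

Lemma Lw_scale u g c x : Lw u (fun x => c * g x) x = c * Lw u g x.
Proof. by have := Lw_lin u (fun=> 0) g c x; rewrite Lw0 add0r => <-; congr Lw;
  apply/funext => y; rewrite add0r. Qed.

Lemma Lw_ge0 u f x : X x -> (forall x, X x -> 0 <= f x) -> 0 <= Lw u f x.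
Proof. by move=> Xx f0; rewrite -(Lw0 u x); exact: Lw_mono. Qed.

Lemma Lw_ge_term a f x : (forall x, X x -> 0 <= f x) -> X (wcons a x) ->
  expR (birkhoff_sum (size a) phi (wcons a x)) * f (wcons a x) <= Lw (map pi a) f x.
Proof.
move=> f0; elim/last_ind: a x => [|a s IH] x; first by rewrite birkhoff_sum0 expR0 mul1r.
rewrite wcons_rcons => Xa.
have Xs : X (scons s x) by have := sft_iter (size a) Xa; rewrite iter_shift_wcons.
rewrite map_rcons Lw_rcons /Lop size_rcons birkhoff_sum_rcons addrC expRD -mulrA.
have /sft_scons[As Xx] := Xs.
rewrite (bigD1 s) ?eqxx//= ler_wpDr//; last by rewrite ler_pM2l ?expR_gt0// IH.
apply: sumr_ge0 => t /andP[/andP[_ At] _]; rewrite mulr_ge0 ?expR_ge0// Lw_ge0//.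
exact/sft_scons.
Qed.

(** Each letter of [u] has at most [#|S|] lifts, each of weight at most [expR M]. *)
Lemma Lw_le_sup (M : R) u f c x : (forall x, X x -> `|phi x| <= M) -> 0 <= c -> X x ->
  (forall a, map pi a = u -> X (wcons a x) -> f (wcons a x) <= c) ->
  Lw u f x <= (#|S|%:R * expR M) ^+ size u * c.
Proof.
move=> HM c0; elim/last_ind: u x => [|u s IH] x Xx H.
  by rewrite expr0 mul1r; exact: (H [::]).
rewrite Lw_rcons /Lop size_rcons.
set d := _ ^+ size u * c in IH *.
have d0 : 0 <= d by rewrite mulr_ge0// exprn_ge0// mulr_ge0// expR_ge0.
have -> : (#|S|%:R * expR M) ^+ (size u).+1 * c = \sum_(t : S) expR M * d.
  have -> : forall c : R, \sum_(t : S) c = #|S|%:R * c by move=> e;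
    rewrite sumr_const mulr_natl.
  by rewrite exprS /d; ring.
rewrite [leLHS]big_mkcond; apply: ler_sum => t _.
case: ifPn => [/andP[/eqP ts At]|_]; last by rewrite mulr_ge0// expR_ge0.
have Xt : X (scons t x) by apply/sft_scons.
apply: (@le_trans _ _ (expR (phi (scons t x)) * d)); last first.
  by rewrite ler_wpM2r// ler_expR (le_trans (ler_norm _))// HM.
rewrite ler_pM2l ?expR_gt0//; apply: IH => // a au Xa.
by rewrite -wcons_rcons; apply: H; rewrite ?wcons_rcons// map_rcons au ts.
Qed.

Definition has_word u x := exists2 a, map pi a = u & X (wcons a x).

(** The sum is empty: against the zero function the hypothesis of [Lw_le] is vacuous in both
    directions. *)
Lemma Lw_has_word u f x : X x -> ~ has_word u x -> Lw u f x = 0.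
Proof.
move=> Xx nu; rewrite -(Lw0 u x).
by apply/le_anti/andP; split; rewrite -[leRHS]mul1r; apply: Lw_le => // a au Xa;
  case: nu; exists a.
Qed.

End operators.

(** * Contraction of the oscillation of quotients *)

Section mixing_words.
Context {S S' : finPointedType}.
Variables (A : rel S) (pi : S -> S').
Implicit Types (x : fullshift S) (a b c : seq S) (u v : seq S').
Local Notation X := (sft A).

(** Fiber-wise mixing for words followed by points: the condition on the last letter becomes that
    [c] can precede [x']. The equal first letters allow whatever can precede [wcons a x] to precede
    [wcons c x']. *)
Definition word_mixing N := forall a b x x', size a = N.+1 -> map pi a = map pi b ->
  X (wcons a x) -> X (wcons b x') ->
  exists c, [/\ map pi c = map pi b, X (wcons c x') & wcons c x' 0%N = wcons a x 0%N].

Lemma admissible_wcons a x : X (wcons a x) -> admissible X a.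
Proof. by move=> Xa; exists (wcons a x), 0%N; rewrite mkseq_wcons. Qed.

Lemma fiberwise_word_mixing :
  fiberwise_subpositive_mixing X pi -> exists N, word_mixing N.
Proof.
move=> [N mixN]; exists N => a b x x' sa ab Xa Xb.
have sb : size b = N.+1 by rewrite -sa -(size_map pi a) ab size_map.
have spa : size (map pi a) == N.+1 by rewrite size_map sa.
have := mixN (Tuple spa) (Tuple (introT eqP sa)) (Tuple (introT eqP sb)).
have adm : admissible (site_map pi @` X) (map pi a).
  exists (site_map pi (wcons a x)), 0%N; split; first by exists (wcons a x).
  by rewrite /= -map_mkseq size_map mkseq_wcons.
move=> /(_ adm (admissible_wcons Xa) (admissible_wcons Xb) erefl (esym ab))[].
move=> [c sc] [] [y [i [Xy /= cE]]] ca.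
rewrite !(tnth_nth (x 0%N))/= => c0 cN; move: (sc) => /eqP sc'.
exists c; split; first by rewrite -ab.
(* Admissibility places [c] before some point of [X]; as [c] and [b] end in the same letter, that
   point can be replaced by [x']. *)
- have Xc : X (wcons c (iter (size c) (@shift S) (iter i (@shift S) y))).
    by rewrite -[in wcons c]cE wcons_mkseq; exact: sft_iter.
  move: cN Xc Xb sc' sb; case/lastP: c {sc cE ca c0} => // c s; case/lastP: b {adm ab} =>
    // b t.
  rewrite !size_rcons !nth_rcons => + + + [sc] [sb]; rewrite sc sb ltnn eqxx => <-.
  exact: sft_wcons_last.
- by rewrite !wcons_nth sa sc'; move: c0 => <-; apply: set_nth_default; rewrite sc'.
Qed.

End mixing_words.

Section contraction.
Context {R : realType} {S S' : finPointedType}.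
Variables (A : rel S) (pi : S -> S') (phi : fullshift S -> R).
Implicit Types (x : fullshift S) (a : seq S) (u v : seq S') (f g h : fullshift S -> R).

Local Notation X := (sft A).
Local Notation Lw := (Lw A pi phi).
Local Notation has_word := (has_word A pi).

(** The bound [g x / h x - g x' / h x' <= V] cleared of denominators, because [h] may vanish. The
    other sign follows by exchanging the points. *)
Definition ratio_var g h k (V : R) := forall x x', X x -> X x' -> agree k x x' ->
  g x * h x' - g x' * h x <= V * (h x * h x').

(** The quotient [g / h] lies in an interval of length [o], in a form that makes [g] vanish wherever
    [h] does. *)
Definition ratio_osc g h (o : R) :=
  exists al : R, forall x, X x -> al * h x <= g x <= (al + o) * h x.

Variables (N : nat) (M K : R).
Hypothesis mixN : word_mixing A pi N.
Hypothesis phi_le : forall x, X x -> `|phi x| <= M.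
Hypothesis bowenK : forall n x x', X x -> X x' -> agree n.+1 x x' ->
  `|birkhoff_sum n phi x - birkhoff_sum n phi x'| <= K.

Lemma X_shift x : X x -> X (@shift S x).
Proof. exact: (@sft_iter _ A 1). Qed.

Lemma agree1 x x' : x 0%N = x' 0%N -> agree 1 x x'.
Proof. by move=> x0 [|i]. Qed.

Lemma wcons_agree1 a x x' : x 0%N = x' 0%N -> agree (size a).+1 (wcons a x) (wcons a x').
Proof. by move=> x0; rewrite -addn1; apply: agree_wcons; exact: agree1. Qed.

Lemma Lw_le_bowen u f f' x x' : x 0%N = x' 0%N -> X x -> X x' ->
  (forall x, X x -> 0 <= f' x) ->
  (forall a, map pi a = u -> X (wcons a x) -> X (wcons a x') ->
    f (wcons a x) <= f' (wcons a x')) ->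
  Lw u f x <= expR K * Lw u f' x'.
Proof.
move=> x0 Xx Xx' f'0 H; apply: Lw_le => // a au Xa.
have Xa' : X (wcons a x') by apply: sft_wcons_eq Xa.
rewrite mulrA -expRD; apply: (@le_trans _ _ (expR (birkhoff_sum (size u) phi (wcons a x))
  * f' (wcons a x'))).
  by rewrite ler_pM2l ?expR_gt0// H.
rewrite ler_wpM2r ?f'0// ler_expR -lerBlDr.
apply: le_trans (ler_norm _) _; apply: bowenK => //.
by rewrite -au size_map; exact: wcons_agree1.
Qed.

(* Constant of the comparison across a window of [N.+1] letters, over which the
   fibre words ending before [x] can be made to end before [x']. *)
Definition Cmix : R := (#|S|%:R * expR M) ^+ N.+1 * expR (N.+1%:R * M).

Lemma Cmix_gt0 : 0 < Cmix.
Proof.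
rewrite mulr_gt0 ?expR_gt0// exprn_gt0// mulr_gt0 ?expR_gt0// ltr0n.
by apply/card_gt0P; exists point.
Qed.

Lemma expR_birkhoff_ge n x : X x -> expR (- (n%:R * M)) <= expR (birkhoff_sum n phi x).
Proof.
move=> Xx; rewrite ler_expR; have := birkhoff_sum_le n X_shift phi_le Xx.
by rewrite ler_norml => /andP[].
Qed.

(** Mixing exchanges a word above [t] before [x] for one before [x'] with the same first letter.
    That single word has weight at least [expR (- (N.+1%:R * M))] and so bounds the value at [x']
    from below; summing over the words before [x] gives the other factor of [Cmix]. *)
Lemma Lw_window t f f' c x x' : size t = N.+1 -> X x -> X x' -> has_word t x' -> 0 <= c ->
  (forall x, X x -> 0 <= f' x) ->
  (forall x x', X x -> X x' -> x 0%N = x' 0%N -> f x <= c * f' x') ->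
  Lw t f x <= Cmix * c * Lw t f' x'.
Proof.
move=> st Xx Xx' [b bt Xb] c0 f'0 ff'.
apply: (@le_trans _ _ ((#|S|%:R * expR M) ^+ size t * (c * (expR (N.+1%:R * M) * Lw t f'
  x')))); last first.
  by rewrite st le_eqVlt; apply/orP; left; apply/eqP; rewrite /Cmix; ring.
apply: Lw_le_sup => //.
  by rewrite !mulr_ge0 ?expR_ge0//; apply: Lw_ge0.
move=> a at_ Xa.
have sa : size a = N.+1 by rewrite -st -at_ size_map.
have [d [db Xd d0]] := mixN sa (etrans at_ (esym bt)) Xa Xb.
apply: (le_trans (ff' _ _ Xa Xd (esym d0))); rewrite ler_wpM2l//.
have := @Lw_ge_term _ _ _ _ pi phi _ _ _ f'0 Xd; rewrite db bt => le1.
rewrite -(@ler_pM2l _ (expR (- (N.+1%:R * M)))) ?expR_gt0// mulrA -expRD addNr expR0 mul1r.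
apply: le_trans le1; rewrite ler_wpM2r ?f'0//.
have -> : size d = N.+1 by rewrite -st -bt -db size_map.
exact: expR_birkhoff_ge.
Qed.

(** In [cone_step] one factor [expR K] pays for changing the tail behind a word above [u], the other
    for comparing [h] at the two resulting points. *)
Definition Dmix : R := Cmix * (expR K * expR K).

Lemma Dmix_gt0 : 0 < Dmix.
Proof. by rewrite mulr_gt0 ?Cmix_gt0// mulr_gt0 ?expR_gt0. Qed.

(** The lower end of the interval is the infimum of [g / h] over the points where [h] is positive;
    if there are none, any value serves. *)
Lemma ratio_osc_of_var g h (o : R) : (forall x, X x -> 0 <= h x) ->
  (forall x, X x -> h x = 0 -> g x = 0) ->
  ratio_var g h 0 o -> ratio_osc g h o.
Proof.
move=> h0 gh var_o.
have [[x1 [Xx1 hx1]]|nex] := pselect (exists x, X x /\ 0 < h x); last first.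
  exists 0 => x Xx; have hx : h x = 0.
    apply/eqP; apply: contra_notT nex => hx; exists x; split=> //.
    by rewrite lt_neqAle eq_sym hx h0.
  by rewrite hx (gh _ Xx hx) !mulr0 lexx.
pose E := [set g x / h x | x in [set x | X x /\ 0 < h x]].
have pairE x x' : X x -> X x' -> 0 < h x -> 0 < h x' -> g x / h x - o <= g x' / h x'.
  move=> Xx Xx' hx hx'; rewrite lerBlDr -lerBlDl.
  (* Agreement on zero letters is vacuous, so the variation bound applies to every pair of
     points. *)
  have := var_o _ _ Xx Xx' (fun _ => fun H => False_ind _ (notF H)).
  rewrite -ler_pdivrMr ?mulr_gt0// => /(le_trans _); apply.
  by rewrite le_eqVlt; apply/orP; left; apply/eqP; field; rewrite !gt_eqF.
have lbE x : X x -> 0 < h x -> lbound E (g x / h x - o).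
  by move=> Xx hx _ [x' [Xx' hx'] <-]; exact: pairE.
have nE : E !=set0 by exists (g x1 / h x1); exists x1.
have hlb : has_lbound E by exists (g x1 / h x1 - o); exact: lbE.
exists (inf E) => x Xx; have [hx|hx] := eqVneq (h x) 0.
  by rewrite hx (gh _ Xx hx) !mulr0 lexx.
have {}hx : 0 < h x by rewrite lt_neqAle eq_sym hx h0.
apply/andP; split.
  by rewrite -ler_pdivlMr//; apply: ge_inf => //; exists x.
rewrite -ler_pdivrMr//.
by rewrite -lerBlDr; apply: lb_le_inf => //; exact: lbE.
Qed.

(** Mixing replaces the word above [t] and keeps its first letter. Putting the same word above [u]
    in front then gives two points that agree on [l.+1] letters, over which [f / h] changes by at
    most [V]. *)
Lemma cone_step f h o V l u t x x' : (forall x, X x -> 0 <= h x) ->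
  (forall x, X x -> 0 <= f x <= o * h x) ->
  (forall x x', X x -> X x' -> x 0%N = x' 0%N -> h x <= expR K * h x') ->
  0 <= V -> ratio_var f h l.+1 V -> size u = l -> size t = N.+1 ->
  X x -> X x' -> has_word t x' ->
  Lw (u ++ t) f x <= Dmix * (Lw (u ++ t) f x' + V * Lw (u ++ t) h x').
Proof.
move=> h0 f0o hK V0 fV su st Xx Xx' tx'; rewrite -Lw_lin !Lw_cat.
have f0 y : X y -> 0 <= f y by move=> /f0o/andP[].
have fVh0 y : X y -> 0 <= f y + V * h y by move=> Xy; rewrite addr_ge0 ?f0// mulr_ge0// h0.
rewrite /Dmix (_ : Lw u (fun x => f x + V * h x) = fun x => Lw u (fun x => f x + V * h x) x)//.
have c0 : 0 <= expR K * expR K by rewrite mulr_ge0 ?expR_ge0.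
apply: (Lw_window st Xx Xx' tx' c0) => [y Xy|y y' ]; first exact: Lw_ge0.
move=> Xy Xy' y0; rewrite -mulrA -Lw_scale.
apply: Lw_le_bowen => // [z Xz|a au Xa Xa']; first by rewrite mulr_ge0 ?expR_ge0// fVh0.
set z := wcons a y in Xa *; set z' := wcons a y' in Xa' *.
rewrite /=; have zz' : agree l.+1 z z' by rewrite -su -au size_map; exact: wcons_agree1.
have hzz' : h z <= expR K * h z' by apply: hK => //; exact: zz'.
have fzz' := fV _ _ Xa Xa' zz'.
have [hz'|hz'] := eqVneq (h z') 0.
  have hz : h z = 0 by apply/le_anti; rewrite h0// andbT; rewrite hz' mulr0 in hzz'.
  have /andP[_] := f0o _ Xa; rewrite hz mulr0 => /le_trans; apply.
  by rewrite mulr_ge0 ?expR_ge0// fVh0.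
have {}hz' : 0 < h z' by rewrite lt_neqAle eq_sym hz' h0.
rewrite -(ler_pM2r hz'); apply: (@le_trans _ _ (h z * (f z' + V * h z'))); first by lra.
by rewrite mulrAC ler_wpM2r ?fVh0.
Qed.

(* Applied to [g - al h] and to [(al + o) h - g], which have the same variation
   relative to [h] up to sign, [cone_step] bounds both ends of the range of [g / h]. *)
Lemma osc_step g h o V l v : 0 <= o -> 0 <= V -> (forall x, X x -> 0 <= h x) ->
  (forall x x', X x -> X x' -> x 0%N = x' 0%N -> h x <= expR K * h x') ->
  ratio_osc g h o -> ratio_var g h l.+1 V -> size v = (l + N.+1)%N ->
  ratio_osc (Lw v g) (Lw v h) ((1 - Dmix ^- 2) * o + 2 * V).
Proof.
move=> o0 V0 h0 hK [al gal] gV sv.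
pose u := take l v; pose t := drop l v.
have vE : v = u ++ t by rewrite cat_take_drop.
have su : size u = l by rewrite size_takel// sv leq_addr.
have st : size t = N.+1 by rewrite size_drop sv addKn.
pose f x := g x + (- al) * h x; pose f2 x := (al + o) * h x + (- 1) * g x.
have f0 x : X x -> 0 <= f x <= o * h x by move=> /gal; rewrite /f => /andP[? ?];
  apply/andP; split; lra.
have f20 x : X x -> 0 <= f2 x <= o * h x by move=> /gal; rewrite /f2 => /andP[? ?];
  apply/andP; split; lra.
have fV : ratio_var f h l.+1 V.
  by move=> x x' Xx Xx' xx'; have := gV _ _ Xx Xx' xx'; rewrite /f; lra.
have f2V : ratio_var f2 h l.+1 V.
  by move=> x x' Xx Xx' xx'; have := gV _ _ Xx' Xx (agree_sym xx'); rewrite /f2; lra.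
have hV : ratio_var h h l.+1 0 by move=> x x' _ _ _; lra.
have h1 x : X x -> 0 <= h x <= 1 * h x by move=> Xx; rewrite mul1r lexx h0.
have Lh0 x : X x -> 0 <= Lw v h x by move=> Xx; apply: Lw_ge0.
have Lgal x : X x -> 0 <= Lw v f x <= o * Lw v h x.
  move=> Xx; rewrite -Lw_scale Lw_ge0//=; last by move=> y /f0/andP[].
  by apply: Lw_mono => // y /f0/andP[].
have LfE x : Lw v f x = Lw v g x + (- al) * Lw v h x by exact: Lw_lin.
have Lf2E x : Lw v f2 x = (al + o) * Lw v h x - Lw v g x.
  by rewrite /f2 -Lw_scale -[- Lw v g x]mulN1r -Lw_lin.
apply: ratio_osc_of_var => //.
  move=> x Xx hx; have := Lgal _ Xx; rewrite LfE hx !mulr0 addr0.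
  by move=> H; apply/le_anti; rewrite andbC.
move=> x x' Xx Xx' _.
(* If no word above the window [t] can precede one of the points, both functions vanish there and so
   does the cross difference. *)
have zero y : X y -> ~ has_word t y -> Lw v h y = 0 /\ Lw v g y = 0.
  by move=> Xy ty; rewrite vE !Lw_cat !Lw_has_word.
have [tx|/(zero _ Xx)[-> ->]] := pselect (has_word t x); last by rewrite !(mul0r,mulr0) subrr.
have [tx'|/(zero _ Xx')[-> ->]] := pselect (has_word t x'); last
  by rewrite !(mul0r,mulr0) subrr.
have D0 := Dmix_gt0.
have fxx' : Lw v f x <= Dmix * (Lw v f x' + V * Lw v h x').
  by rewrite vE; exact: (cone_step h0 f0 hK V0 fV su st).
have f2x'x : Lw v f2 x' <= Dmix * (Lw v f2 x + V * Lw v h x).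
  by rewrite vE; exact: (cone_step h0 f20 hK V0 f2V su st).
have hxx' : Lw v h x <= Dmix * Lw v h x'.
  by rewrite -[leRHS]/(Dmix * _) -[Lw v h x' in leRHS]addr0 -[0 in leRHS](mul0r (Lw v h
    x')) vE; apply: (cone_step h0 h1 hK (lexx 0) hV su st).
have hx'x : Lw v h x' <= Dmix * Lw v h x.
  by rewrite -[leRHS]/(Dmix * _) -[Lw v h x in leRHS]addr0 -[0 in leRHS](mul0r (Lw v h
    x)) vE; apply: (cone_step h0 h1 hK (lexx 0) hV su st).
have := Lgal _ Xx; have := Lgal _ Xx'.
move: fxx' f2x'x; rewrite !LfE !Lf2E.
have := Lh0 _ Xx; have := Lh0 _ Xx'; move: hxx' hx'x.
move: (Lw v h x) (Lw v h x') (Lw v g x) (Lw v g x') Dmix D0 => a b p q D D0.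
move=> ab ba b0 a0 E1 E2 /andP[F1 F2] /andP[F3 F4].
have [az|az] := eqVneq a 0.
  have -> : b = 0 by apply/le_anti; rewrite b0 andbT (le_trans ba)// az mulr0.
  by rewrite az !mulr0 subrr.
have {}a0 : 0 < a by rewrite lt_neqAle eq_sym az a0.
have {}b0 : 0 < b by rewrite -(pmulr_rgt0 _ D0); apply: lt_le_trans ab.
(* [r] and [s] are the two quotients measured from [al]. The square in [d] arises because [D] is
   paid twice: in [cone_step], and in comparing [a] with [b]. *)
pose r := p / a - al; pose s := q / b - al; pose d := D ^- 2.
have pE : p = (r + al) * a by rewrite /r; field.
have qE : q = (s + al) * b by rewrite /s; field; rewrite gt_eqF.
have D2 : 0 < D ^+ 2 by rewrite exprn_gt0.
have D21 : 1 <= D ^+ 2.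
  rewrite -(ler_pM2r a0) mul1r (le_trans ab)// expr2 -mulrA ler_pM2l//.
have d0 : 0 < d by rewrite invr_gt0.
have d1 : d <= 1 by rewrite invf_le1.
have aD : D * (D * a) = D ^+ 2 * a by rewrite expr2 mulrA.
have bD : D * (D * b) = D ^+ 2 * b by rewrite expr2 mulrA.
have dD y : d * (D ^+ 2 * y) = y by rewrite mulrA mulVf ?mul1r// gt_eqF.
have sV : 0 <= s + V by rewrite addr_ge0// /s; rewrite subr_ge0 ler_pdivlMr//; lra.
have rV : 0 <= o - r + V.
  by rewrite addr_ge0// subr_ge0 /r lerBlDl ler_pdivrMr//; lra.
have G1 : d * r <= s + V.
  rewrite -(ler_pM2l D2) mulrA mulfV ?gt_eqF// mul1r -(ler_pM2r a0).
  apply: (@le_trans _ _ (D * ((s + V) * b))); first by move: E1; rewrite pE qE; lra.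
  by rewrite expr2 -!mulrA ler_pM2l// mulrCA; apply: ler_wpM2l.
have G2 : d * (o - s) <= o - r + V.
  rewrite -(ler_pM2l D2) mulrA mulfV ?gt_eqF// mul1r -(ler_pM2r b0).
  apply: (@le_trans _ _ (D * ((o - r + V) * a))); first by move: E2; rewrite pE qE; lra.
  by rewrite expr2 -!mulrA ler_pM2l// mulrCA; apply: ler_wpM2l.
have -> : p * b - q * a = (r - s) * (a * b) by rewrite pE qE; ring.
have ab0 : 0 <= a * b by rewrite mulr_ge0 ?ltW.
rewrite ler_wpM2r// -/d.
(* The sum of [G1] and [G2]. *)
have G3 : (1 + d) * (r - s) <= (1 - d) * o + 2 * V by lra.
have [rs|rs] := leP s r.
  by apply: le_trans G3; rewrite ler_peMl ?subr_ge0//; lra.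
apply: (@le_trans _ _ 0); first by lra.
by rewrite addr_ge0 ?mulr_ge0 ?subr_ge0.
Qed.

(** A word of length [l] in front turns agreement on [k] letters into agreement on [l + k], which
    brings in [V]. Changing the tail distorts numerator and denominator by [expR E] each. *)
Lemma var_step g h o V E k l v : 0 <= o -> 0 <= V -> 0 <= E -> (0 < k)%N ->
  (forall x, X x -> 0 <= h x) ->
  (forall a x x', size a = l -> X (wcons a x) -> X (wcons a x') -> agree k x x' ->
    expR (birkhoff_sum l phi (wcons a x)) * h (wcons a x) <=
    expR E * (expR (birkhoff_sum l phi (wcons a x')) * h (wcons a x'))) ->
  ratio_osc g h o -> ratio_var g h (l + k) V -> size v = l ->
  ratio_var (Lw v g) (Lw v h) k ((expR (2 * E) - 1) * o + expR (2 * E) * V).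
Proof.
move=> o0 V0 E0 k0 h0 hE [al gal] gV sv x x' Xx Xx' xx'.
(* Subtracting [al * h] leaves the cross difference unchanged and bounds the numerator by [o * h],
   so the distortion of the weights costs a multiple of [o]. *)
pose f x := g x + (- al) * h x.
have x0 : x 0%N = x' 0%N by exact: xx'.
have f0 y : X y -> 0 <= f y <= o * h y by move=> /gal; rewrite /f => /andP[? ?];
  apply/andP; split; lra.
have fV : ratio_var f h (l + k) V.
  by move=> y y' Xy Xy' yy'; have := gV _ _ Xy Xy' yy'; rewrite /f; lra.
have Lgal y : X y -> 0 <= Lw v f y <= o * Lw v h y.
  move=> Xy; rewrite -Lw_scale Lw_ge0//=; last by move=> z /f0/andP[].
  by apply: Lw_mono => // z /f0/andP[].
have LfE y : Lw v f y = Lw v g y + (- al) * Lw v h y by exact: Lw_lin.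
have hx'x : Lw v h x' <= expR E * Lw v h x.
  apply: Lw_le => // a av Xa; rewrite sv; apply: hE (agree_sym xx') => //.
    by rewrite -sv -av size_map.
  by apply: sft_wcons_eq Xa.
have fxx' : Lw v f x <= expR E * (Lw v f x' + V * Lw v h x').
  rewrite -Lw_lin; apply: Lw_le => // a av Xa; rewrite sv.
  have sa : size a = l by rewrite -sv -av size_map.
  have Xa' : X (wcons a x') by apply: sft_wcons_eq Xa.
  have := hE _ _ _ sa Xa Xa' xx'; have := fV _ _ Xa Xa'.
  rewrite -{1}sa => /(_ (agree_wcons xx')).
  have := f0 _ Xa; have := f0 _ Xa'; have := h0 _ Xa; have := h0 _ Xa'.
  move: (wcons a x) (wcons a x') => z z' /=.
  have := expR_gt0 (birkhoff_sum l phi z); have := expR_gt0 (birkhoff_sum l phi z').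
  move: (expR (birkhoff_sum l phi z)) (expR (birkhoff_sum l phi z')) => e e'.
  move=> e'0 e0 hz'0 hz0 /andP[fz'0 fz'o] /andP[fz0 fzo] G1 G2.
  have eE := expR_gt0 E.
  have W : 0 <= f z' + V * h z' by apply: addr_ge0 fz'0 _; apply: mulr_ge0.
  have [hz'|hz'] := eqVneq (h z') 0.
    have ehz : e * h z = 0.
      by apply/le_anti; rewrite (mulr_ge0 (ltW e0) hz0) andbT; rewrite hz' !mulr0 in G2.
    have hz : h z = 0 by move/eqP: ehz; rewrite mulf_eq0 gt_eqF//= => /eqP.
    have -> : f z = 0 by apply/le_anti; rewrite fz0 andbT; rewrite hz mulr0 in fzo.
    by rewrite mulr0; apply: mulr_ge0 (ltW eE) _; apply: mulr_ge0 (ltW e'0) W.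
  have {}hz' : 0 < h z' by rewrite lt_neqAle eq_sym hz' hz'0.
  rewrite -(ler_pM2r hz'); apply: (@le_trans _ _ (e * h z * (f z' + V * h z'))).
    by rewrite -!mulrA ler_pM2l//; lra.
  have -> : expR E * (e' * (f z' + V * h z')) * h z' =
    expR E * (e' * h z') * (f z' + V * h z') by ring.
  by rewrite ler_wpM2r.
have -> : Lw v g x * Lw v h x' - Lw v g x' * Lw v h x =
  Lw v f x * Lw v h x' - Lw v f x' * Lw v h x.
  by rewrite !LfE; ring.
have := Lgal _ Xx; have := Lgal _ Xx'.
have : 0 <= Lw v h x by apply: Lw_ge0.
have : 0 <= Lw v h x' by apply: Lw_ge0.
move: fxx' hx'x; move: (Lw v f x) (Lw v f x') (Lw v h x) (Lw v h x') => p q a b.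
move=> pq ba b0 a0 /andP[q0 qb] /andP[p0 pa].
have eE : 1 <= expR E by rewrite -expR0 ler_expR.
have -> : expR (2 * E) = expR E * expR E by rewrite -expRD; congr expR; ring.
have H1 : p * b <= expR E * (q + V * b) * (expR E * a).
  by apply: ler_pM.
move: eE H1; set e := expR E => eE H1.
have H2 : (e * e - 1) * (q * a) <= (e * e - 1) * (o * b * a).
  by rewrite ler_wpM2l//; [rewrite subr_ge0 mulr_ege1|rewrite ler_wpM2r].
lra.
Qed.

End contraction.

(** * Decay of the oscillation, uniform and exponential *)

Section convergence.
Context {R : realType} {S S' : finPointedType}.
Variables (A : rel S) (pi : S -> S') (phi : fullshift S -> R).
Implicit Types (x : fullshift S) (a : seq S) (u v : seq S') (f g h : fullshift S -> R).

Local Notation X := (sft A).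
Local Notation Lw := (Lw A pi phi).
Local Notation ratio_var := (ratio_var A).
Local Notation ratio_osc := (ratio_osc A).

Variables (N : nat) (M K : R).
Hypothesis mixN : word_mixing A pi N.
Hypothesis M_ge0 : 0 <= M.
Hypothesis phi_le : forall x, X x -> `|phi x| <= M.
Hypothesis K_ge0 : 0 <= K.
Hypothesis bowenK : forall n x x', X x -> X x' -> agree n.+1 x x' ->
  `|birkhoff_sum n phi x - birkhoff_sum n phi x'| <= K.

Local Notation D := (@Dmix R S N M K).

Lemma Dmix_ge1 : 1 <= D.
Proof.
have e1 c : 0 <= c -> 1 <= expR c :> R by move=> c0; rewrite -expR0 ler_expR.
apply: mulr_ege1; last by rewrite mulr_ege1 ?e1.
rewrite mulr_ege1 ?e1 ?mulr_ge0// exprn_ege1// mulr_ege1 ?e1// ler1n.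
by apply/card_gt0P; exists point.
Qed.

Local Notation d := (D ^- 2).

Lemma contraction_gt0 : 0 < d.
Proof. by rewrite invr_gt0 exprn_gt0// (lt_le_trans ltr01)// Dmix_ge1. Qed.

Lemma contraction_le1 : d <= 1.
Proof. by rewrite invf_le1 ?exprn_gt0 ?(lt_le_trans ltr01) ?exprn_ege1// Dmix_ge1. Qed.

Lemma ratio_osc_Lw g h o v : ratio_osc g h o -> ratio_osc (Lw v g) (Lw v h) o.
Proof.
move=> [al H]; exists al => x Xx; rewrite -!Lw_scale.
by apply/andP; split; apply: Lw_mono => // y /H/andP[].
Qed.

Lemma ratio_osc_le g h o o' : (forall x, X x -> 0 <= h x) -> o <= o' ->
  ratio_osc g h o -> ratio_osc g h o'.
Proof.
move=> h0 oo' [al H]; exists al => x Xx; have /andP[-> /le_trans->//] := H _ Xx.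
by rewrite ler_wpM2r ?h0// lerD2l.
Qed.

Lemma ratio_var_le g h k k' V V' : (forall x, X x -> 0 <= h x) -> (k <= k')%N -> V <= V' ->
  ratio_var g h k V -> ratio_var g h k' V'.
Proof.
move=> h0 kk' VV' H x x' Xx Xx' xx'; apply: (le_trans (H _ _ Xx Xx' _)).
  exact: agree_leq xx'.
by rewrite ler_wpM2r ?mulr_ge0 ?h0.
Qed.

Lemma Lw1_ge0 u x : X x -> 0 <= Lw u (fun=> 1) x.
Proof. by move=> Xx; apply: Lw_ge0. Qed.

Lemma Lw1_le u x x' E : x 0%N = x' 0%N -> X x -> X x' ->
  (forall a, size a = size u -> X (wcons a x) -> X (wcons a x') ->
    `|birkhoff_sum (size u) phi (wcons a x) - birkhoff_sum (size u) phi (wcons a x')| <= E) ->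
  Lw u (fun=> 1) x <= expR E * Lw u (fun=> 1) x'.
Proof.
move=> x0 Xx Xx' H; apply: Lw_le => // a au Xa.
rewrite !mulr1 -expRD ler_expR -lerBlDr (le_trans (ler_norm _))// H//.
  by rewrite -au size_map.
exact: sft_wcons_eq Xa.
Qed.

Lemma Lw1_bowen u x x' : X x -> X x' -> x 0%N = x' 0%N ->
  Lw u (fun=> 1) x <= expR K * Lw u (fun=> 1) x'.
Proof.
move=> Xx Xx' x0; apply: Lw1_le => // a <- Xa Xa'; apply: bowenK => //.
exact: wcons_agree1.
Qed.

Lemma expR_sub1_le (x : R) : expR x - 1 <= x * expR x.
Proof.
have := expR_ge1Dx (- x); rewrite -(ler_pM2r (expR_gt0 x)) -expRD addNr expR0; lra.
Qed.

Lemma exprn_small (r e : R) : 0 <= r < 1 -> 0 < e -> exists n, r ^+ n <= e.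
Proof.
move=> /andP[r0 r1] e0; have : `|r| < 1 by rewrite ger0_norm.
move=> /cvg_expr /cvgr0_norm_le /(_ _ e0) [n _ H]; exists n.
by have := H n (leqnn n); rewrite ger0_norm// exprn_ge0.
Qed.

(** Each round multiplies the oscillation by [1 - d / 2]. The threshold [J] reached so far is a
    fixed length, so [phiU] at [j = J] makes the variation after [J] letters as small as the next
    round requires, uniformly over [G]. *)
Lemma osc_small (G : set (fullshift S -> R)) :
  (forall j e, 0 < e -> exists k, forall x x', X x -> X x' -> agree (j + k) x x' ->
    `|birkhoff_sum j phi x - birkhoff_sum j phi x'| <= e) ->
  (forall g, G g -> ratio_osc g (fun=> 1) 1) ->
  (forall e, 0 < e -> exists k, forall g, G g -> ratio_var g (fun=> 1) k e) ->
  forall e, 0 < e -> exists J, forall g v, G g -> (J <= size v)%N ->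
    ratio_osc (Lw v g) (Lw v (fun=> 1)) e.
Proof.
move=> phiU Gosc Gvar e e0.
suff main n : exists J, forall g v, G g -> (J <= size v)%N ->
    ratio_osc (Lw v g) (Lw v (fun=> 1)) ((1 - d / 2) ^+ n).
  have [|n le_n] := @exprn_small (1 - d / 2) e _ e0.
    by have := contraction_gt0; have := contraction_le1; lra.
  have [J HJ] := main n; exists J => g v Gg Jv.
  by apply: ratio_osc_le (HJ _ _ Gg Jv) => //; exact: Lw1_ge0.
elim: n => [|n [J HJ]].
  by exists 0%N => g v Gg _; rewrite expr0; apply: ratio_osc_Lw; exact: Gosc.
(* With variation [e'], [osc_step] gives [(1 - d) * o + 2 * e'], which is exactly
   [(1 - d / 2) * o]. *)
set o := (1 - d / 2) ^+ n in HJ; pose e' := d * o / 4.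
have o0 : 0 < o by rewrite exprn_gt0//; have := contraction_le1; lra.
have e'0 : 0 < e' by rewrite divr_gt0// mulr_gt0// contraction_gt0.
pose e1 := expR 1 : R; have e10 : 0 < e1 by exact: expR_gt0.
(* [E] and [V] make each of the two terms produced by [var_step] at most [e' / 2]. *)
pose E := Num.min (1 / 2) (e' / (4 * e1)).
have E0 : 0 < E by rewrite lt_min divr_gt0//= divr_gt0// mulr_gt0.
pose V := e' / (2 * e1).
have V0 : 0 < V by rewrite divr_gt0// mulr_gt0.
have [k1 Hk1] := phiU J E E0.
have [k2 Hk2] := Gvar V V0.
pose l := maxn k1 k2.
have EV : (expR (2 * E) - 1) * 1 + expR (2 * E) * V <= e'.
  have le1 : expR (2 * E) <= e1.
    by rewrite ler_expR; have : E <= 1 / 2 by [rewrite ge_min lexx]; lra.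
  have le2 : E <= e' / (4 * e1) by rewrite ge_min lexx orbT.
  have le3 : 2 * E * e1 <= e' / 2.
    have -> : e' / 2 = 2 * (e' / (4 * e1)) * e1 by field; rewrite gt_eqF.
    by rewrite ler_pM2r// ler_pM2l.
  have le4 : 2 * E * expR (2 * E) <= 2 * E * e1 by rewrite ler_pM2l// mulr_gt0.
  have le5 : expR (2 * E) * V <= e' / 2.
    have -> : e' / 2 = e1 * V by rewrite /V; field; rewrite gt_eqF.
    by rewrite ler_pM2r.
  by have := expR_sub1_le (2 * E); lra.
(* [J] letters for the previous round, [l] for small variation, and a mixing window. Any further
   letters keep the oscillation bound, by [ratio_osc_Lw]. *)
exists (J + (l + N.+1))%N => g v Gg sv.
rewrite -(cat_take_drop (J + (l + N.+1)) v) 2!Lw_cat; apply: ratio_osc_Lw.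
have sv' : size (take (J + (l + N.+1)) v) = (J + (l + N.+1))%N by rewrite size_takel.
move: (take _ v) sv' => {sv}{}v sv.
rewrite -(cat_take_drop J v) 2!Lw_cat.
have sJ : size (take J v) = J by rewrite size_takel// sv leq_addr.
have sl : size (drop J v) = (l + N.+1)%N by rewrite size_drop sv addKn.
move: (take J v) (drop J v) sJ sl => w1 w2 sJ sl.
have -> : (1 - d / 2) ^+ n.+1 = (1 - d) * o + 2 * e' by rewrite exprS -/o /e'; field;
  rewrite gt_eqF// (lt_le_trans ltr01)// Dmix_ge1.
apply: (@osc_step _ _ _ _ _ _ _ M K mixN phi_le bowenK _ _ o e' l) => //.
- exact: ltW.
- exact: ltW.
- exact: Lw1_ge0.
- by move=> x x' Xx Xx' x0; exact: Lw1_bowen.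
- by apply: HJ => //; rewrite sJ.
apply: (@ratio_var_le _ _ l.+1 _ _ _ _ _ EV) => //; first exact: Lw1_ge0.
apply: (@var_step _ _ _ _ _ _ _ _ _ _ _ _ J) => //.
- exact: ltW.
- exact: ltW.
- move=> a x x' sa Xa Xa' xx'; rewrite !mulr1 -expRD ler_expR -lerBlDr.
  rewrite (le_trans (ler_norm _))// Hk1//.
  by rewrite -sa; apply: agree_wcons; apply: agree_leq xx'; rewrite leqW// leq_maxl.
- exact: Gosc.
- apply: (ratio_var_le _ _ (lexx _) (Hk2 _ Gg)) => //.
  by rewrite (leq_trans (leq_maxr k1 k2))// (leq_trans (leqnSn l))// leq_addl.
Qed.

(** The word is read in blocks of fixed length [b]. Oscillation and variation are carried through
    the induction together, since each block improves either bound by means of the other. *)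
Lemma osc_expo (G : set (fullshift S -> R)) (c0 c1 th : R) :
  0 <= c0 -> 0 < th < 1 ->
  (forall j k x x', X x -> X x' -> agree (j + k) x x' ->
    `|birkhoff_sum j phi x - birkhoff_sum j phi x'| <= c0 * th ^+ k) ->
  (forall g, G g -> ratio_osc g (fun=> 1) 1) ->
  (forall g k, G g -> (0 < k)%N -> ratio_var g (fun=> 1) k (c1 * th ^+ k)) ->
  exists c r, [/\ 0 < c, 0 < r < 1 & forall g v, G g ->
    ratio_osc (Lw v g) (Lw v (fun=> 1)) (c * r ^+ size v)].
Proof.
move=> c00 /andP[th0 th1] phiU Gosc Gvar.
have d0 := contraction_gt0; have d1 := contraction_le1.
pose q := expR (4 * c0); have q0 : 0 < q by exact: expR_gt0.
pose C1 := 4 * c0 * q; have C10 : 0 <= C1 by rewrite !mulr_ge0// ltW.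
pose B := `|c1| + 4 * C1 + 1.
have B0 : 0 < B by rewrite /B; have := normr_ge0 c1; lra.
pose r := 1 - d / 2.
have r0 : 0 < r by rewrite /r; lra.
have r1 : r < 1 by rewrite /r; lra.
(* The first bound on [th ^+ l] lets a block absorb the old variation, the second keeps the
   variation term of [osc_step] below half of the gain [d]. *)
have [l] : exists l, th ^+ l <= Num.min (1 / (4 * q)) (d / (4 * B)).
  apply: exprn_small; first by rewrite th1 ltW.
  by rewrite lt_min !divr_gt0 ?mulr_gt0.
rewrite le_min => /andP[l1 l2].
pose b := (l + N.+1)%N.
have thl m : th ^+ (l + m) <= th ^+ l.
  by rewrite exprD ler_piMr ?exprn_ge0 ?exprn_ile1 ?ltW.
have l3 : q * th ^+ b <= 1 / 4.
  have -> : 1 / 4 = q * (1 / (4 * q)) by field; rewrite gt_eqF.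
  by rewrite ler_pM2l// (le_trans (thl _)).
have l4 : 2 * (B * th ^+ l.+1) <= d / 2.
  have -> : d / 2 = 2 * (B * (d / (4 * B))) by field;
    rewrite !gt_eqF// (lt_le_trans ltr01)// Dmix_ge1.
  by rewrite !ler_pM2l// -addn1 (le_trans (thl _)).
have main n g v : G g -> size v = (n * b)%N ->
    ratio_osc (Lw v g) (Lw v (fun=> 1)) (r ^+ n) /\
    forall k, (0 < k)%N -> ratio_var (Lw v g) (Lw v (fun=> 1)) k (B * r ^+ n * th ^+ k).
  move=> Gg; elim: n v => [|n IH] v sv.
    rewrite expr0 mulr1; split; first by apply: ratio_osc_Lw; exact: Gosc.
    move=> k k0; move/eqP: sv; rewrite mul0n size_eq0 => /eqP ->.
    apply: (ratio_var_le _ (leqnn k) _ (Gvar _ _ Gg k0)) => //=.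
    rewrite ler_wpM2r ?exprn_ge0 ?ltW// /B; have := ler_norm c1; lra.
  rewrite -(cat_take_drop (n * b) v) 2!Lw_cat.
  have sn : size (take (n * b) v) = (n * b)%N by rewrite size_takel// sv leq_mul.
  have sb : size (drop (n * b) v) = b by rewrite size_drop sv mulSn addnK.
  move: (take _ v) (drop _ v) sn sb => {sv}{}v w sv sw.
  have [IHo IHV] := IH v sv.
  have rn0 : 0 < r ^+ n by rewrite exprn_gt0.
  split.
    apply: (@ratio_osc_le _ _ ((1 - d) * r ^+ n + 2 * (B * r ^+ n * th ^+ l.+1))).
    - by move=> x Xx; rewrite -Lw_cat; exact: Lw1_ge0.
    - have -> : (1 - d) * r ^+ n + 2 * (B * r ^+ n * th ^+ l.+1) =
        ((1 - d) + 2 * (B * th ^+ l.+1)) * r ^+ n by ring.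
      by rewrite [r ^+ n.+1]exprS ler_pM2r//; rewrite /r in l4 *; lra.
    apply: (@osc_step _ _ _ _ _ _ _ M K mixN phi_le bowenK _ _ (r ^+ n) (B * r ^+ n * th
      ^+ l.+1) l) => //.
    - exact: ltW.
    - by rewrite !mulr_ge0 ?exprn_ge0// ltW.
    - exact: Lw1_ge0.
    - by move=> x x' Xx Xx' x0; exact: Lw1_bowen.
    - exact: IHV.
  move=> k k0.
  (* One [c0 * th ^+ k] for the Birkhoff sum over the new block, one for the function
     [Lw v (fun=> 1)] behind it. *)
  pose E := 2 * c0 * th ^+ k.
  have thk : th ^+ k <= 1 by rewrite exprn_ile1 ?ltW.
  have thk0 : 0 <= th ^+ k by rewrite exprn_ge0 ?ltW.
  have E0 : 0 <= E by rewrite !mulr_ge0.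
  apply: (@ratio_var_le _ _ k _ ((expR (2 * E) - 1) * r ^+ n + expR (2 * E) * (B * r ^+ n
    * th ^+ (b + k)))) => //.
  - by move=> x Xx; rewrite -Lw_cat; exact: Lw1_ge0.
  - have eq : expR (2 * E) <= q by rewrite ler_expR /E; have :=
    ler_pM c00 thk0 (lexx c0) thk; lra.
    have e1 : expR (2 * E) - 1 <= C1 * th ^+ k.
      apply: (le_trans (expR_sub1_le _)).
      have -> : C1 * th ^+ k = 2 * E * q by rewrite /C1 /E; ring.
      by rewrite ler_wpM2l// mulr_ge0.
    apply: (@le_trans _ _ (C1 * th ^+ k * r ^+ n + q * (B * r ^+ n * th ^+ (b + k)))).
      by rewrite lerD// ler_wpM2r// ?(ltW rn0)// !mulr_ge0 ?exprn_ge0// ltW.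
    have -> : C1 * th ^+ k * r ^+ n + q * (B * r ^+ n * th ^+ (b + k)) =
      (C1 + (q * th ^+ b) * B) * (r ^+ n * th ^+ k) by rewrite exprD; ring.
    have -> : B * r ^+ n.+1 * th ^+ k = (B * r) * (r ^+ n * th ^+ k) by rewrite exprS; ring.
    rewrite ler_wpM2r ?mulr_ge0 ?exprn_ge0 ?(ltW r0) ?(ltW th0)//.
    have B1 : q * th ^+ b * B <= 1 / 4 * B by rewrite ler_pM2r.
    have B2 : B * (1 / 2) <= B * r by rewrite ler_pM2l// /r; lra.
    by have : 4 * C1 <= B by [rewrite /B; have := normr_ge0 c1; lra]; lra.
  apply: (@var_step _ _ _ _ _ _ _ _ _ _ _ _ b) => //.
  - exact: ltW.
  - by rewrite !mulr_ge0 ?exprn_ge0// ltW.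
  - exact: Lw1_ge0.
  - move=> a x x' sa Xa Xa' xx'.
    have H1 : Lw v (fun=> 1) (wcons a x) <= expR (c0 * th ^+ k) * Lw v (fun=> 1) (wcons a x').
      apply: Lw1_le => //; first by apply: (agree_wcons xx'); rewrite ltn_addl.
      move=> a' sa' Xa1 Xa2; apply: phiU => //; rewrite -sa'.
      apply: agree_wcons; apply: agree_leq (agree_wcons xx'); exact: leq_addl.
    have H2 : expR (birkhoff_sum b phi (wcons a x)) <=
      expR (c0 * th ^+ k) * expR (birkhoff_sum b phi (wcons a x')).
      rewrite -expRD ler_expR -lerBlDr (le_trans (ler_norm _))// phiU//.
      by rewrite -sa; exact: agree_wcons.
    apply: (le_trans (ler_pM (expR_ge0 _) (Lw1_ge0 _ Xa) H2 H1)).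
    have -> : expR E = expR (c0 * th ^+ k) * expR (c0 * th ^+ k).
      by rewrite -expRD; congr expR; rewrite /E; ring.
    by rewrite le_eqVlt; apply/orP; left; apply/eqP; ring.
  - by apply: IHV; rewrite addn_gt0 k0 orbT.
have b0 : (0 < b)%N by rewrite /b addnS.
pose r' := r `^ b%:R^-1.
have r'b : r' ^+ b = r by rewrite -powR_mulrn ?powR_ge0// -powRrM mulVf ?powRr1 ?ltW//
  pnatr_eq0 -lt0n.
have r'0 : 0 < r' by exact: powR_gt0.
have r'1 : r' < 1.
  rewrite ltNge; apply/negP => /(exprn_ege1 b); rewrite r'b.
  by move/(lt_le_trans r1); rewrite ltxx.
(* [r'] is the rate per letter, a [b]-th root of [r]; the factor [r^-1] accounts for an incomplete
   last block. *)
exists r^-1, r'; split; [by rewrite invr_gt0|by rewrite r'0|].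
move=> g v Gg; pose n := (size v %/ b)%N.
have sn : size (take (n * b) v) = (n * b)%N by rewrite size_takel// leq_trunc_div.
have [osc_n _] := main n g _ Gg sn.
have := ratio_osc_Lw (drop (n * b) v) osc_n.
rewrite -2!Lw_cat cat_take_drop; apply: ratio_osc_le; first exact: Lw1_ge0.
rewrite ler_pdivlMl// -exprS -r'b -exprM.
apply: ler_wiXn2l; rewrite ?ltW//.
by rewrite ltnW// mulnC ltn_ceil.
Qed.

End convergence.

(** * Quasi-multiplicativity of the partition function *)

Section partition_function.
Context {R : realType} {S S' : finPointedType}.
Variables (A : rel S) (pi : S -> S') (phi : fullshift S -> R).
Implicit Types (x : fullshift S) (y : fullshift S') (a : seq S) (u v : seq S').
Implicit Types (f g h : fullshift S -> R).

Local Notation X := (sft A).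
Local Notation Y := (site_map pi @` X).
Local Notation Lw := (Lw A pi phi).
Local Notation ratio_var := (ratio_var A).
Local Notation ratio_osc := (ratio_osc A).
Local Notation has_word := (has_word A pi).

Variables (N : nat) (M K : R).
Hypothesis mixN : word_mixing A pi N.
Hypothesis M_ge0 : 0 <= M.
Hypothesis phi_le : forall x, X x -> `|phi x| <= M.
Hypothesis K_ge0 : 0 <= K.
Hypothesis bowenK : forall n x x', X x -> X x' -> agree n.+1 x x' ->
  `|birkhoff_sum n phi x - birkhoff_sum n phi x'| <= K.

Variable z : S -> fullshift S.
Hypothesis Xz : forall s, X (z s).
Hypothesis z_head : forall x, X x -> z (x 0%N) 0%N = x 0%N.

Definition Zw u : R := \sum_(s : S) Lw u (fun=> 1) (z s).

Local Notation Cm := (@Cmix R S N M).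
Local Notation card := (#|S|%:R : R).

Lemma card_gt0 : 0 < card.
Proof. by rewrite ltr0n; apply/card_gt0P; exists point. Qed.

Lemma Lw1_le_Zw u x : X x -> Lw u (fun=> 1) x <= expR K * Zw u.
Proof.
move=> Xx; apply: (@le_trans _ _ (expR K * Lw u (fun=> 1) (z (x 0%N)))).
  by apply: (@Lw1_bowen _ _ _ _ _ _ _ bowenK) => //; rewrite z_head.
rewrite ler_pM2l ?expR_gt0// /Zw (bigD1 (x 0%N))//= lerDl.
by apply: sumr_ge0 => s _; exact: Lw1_ge0.
Qed.

Lemma Zw_ge0 u : 0 <= Zw u.
Proof. by apply: sumr_ge0 => s _; exact: Lw1_ge0. Qed.

Lemma Zw_cat_le u v : Zw (u ++ v) <= expR K * Zw u * Zw v.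
Proof.
rewrite /Zw [leRHS]mulr_sumr; apply: ler_sum => s _.
rewrite Lw_cat -Lw_scale; apply: Lw_mono => // x Xx.
by rewrite mulr1; exact: Lw1_le_Zw.
Qed.

Lemma has_word_suffix u t x : has_word (u ++ t) x -> has_word t x.
Proof.
move=> [a aE Xa]; exists (drop (size u) a); first by rewrite map_drop aE drop_size_cat.
have : X (wcons (take (size u) a ++ drop (size u) a) x) by rewrite cat_take_drop.
rewrite wcons_cat => /(sft_iter (size (take (size u) a))).
by rewrite iter_shift_wcons.
Qed.

(** The last [N.+1] letters of a long word serve as the mixing window, the earlier ones costing
    [expR K]. For at most [N] letters, counting words and bounding their weights is enough. *)
Lemma Lw1_window u x x' : X x -> X x' -> has_word u x' ->
  Lw u (fun=> 1) x <= Cm * expR K * Lw u (fun=> 1) x'.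
Proof.
move=> Xx Xx' ux'.
have [uN|Nu] := leqP (size u) N.
  have eM : 1 <= expR M by rewrite -expR0 ler_expR.
  have [a au Xa] := ux'.
  have := @Lw_ge_term _ _ _ _ pi phi _ (fun=> 1) _ (fun _ _ => ler01) Xa.
  rewrite au mulr1 => le1.
  have le2 : expR (- (N.+1%:R * M)) <= Lw u (fun=> 1) x'.
    apply: le_trans le1; apply: le_trans (expR_birkhoff_ge phi_le _ Xa).
    rewrite ler_expR lerN2 ler_wpM2r// ler_nat -(size_map pi) au.
    exact: (leq_trans uN).
  apply: (@le_trans _ _ ((card * expR M) ^+ N.+1 * 1)).
    apply: (@le_trans _ _ ((card * expR M) ^+ size u * 1)).
      exact: (@Lw_le_sup _ _ _ _ _ _ M).
    rewrite !mulr1 ler_weXn2l ?(leq_trans uN)// mulr_ege1// ler1n.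
    by apply/card_gt0P; exists point.
  rewrite /Cmix -!mulrA ler_wpM2l ?exprn_ge0 ?mulr_ge0 ?expR_ge0//.
  rewrite [leLHS](_ : 1 = expR (N.+1%:R * M) * (1 * expR (- (N.+1%:R * M)))); last first.
    by rewrite mul1r -expRD subrr expR0.
  rewrite ler_pM2l ?expR_gt0// ler_pM ?expR_ge0//.
  by rewrite -expR0 ler_expR.
rewrite -(cat_take_drop (size u - N.+1) u) !Lw_cat.
apply: (Lw_window mixN phi_le) => //; first by rewrite size_drop subKn.
- by apply: (@has_word_suffix (take (size u - N.+1) u)); rewrite cat_take_drop.
- exact: Lw1_ge0.
- by move=> w w' Xw Xw' w0; exact: (@Lw1_bowen _ _ _ _ _ _ _ bowenK).
Qed.

Lemma Zw_le_word u x : X x -> has_word u x ->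
  Zw u <= card * (Cm * expR K) * Lw u (fun=> 1) x.
Proof.
move=> Xx ux; apply: (@le_trans _ _ (\sum_(s : S) Cm * expR K * Lw u (fun=> 1) x)).
  by apply: ler_sum => s _; apply: Lw1_window.
by rewrite sumr_const -(mulrA card) mulr_natl.
Qed.

Lemma has_word_mkseq n x : X x ->
  has_word (mkseq (site_map pi x) n) (iter n (@shift S) x).
Proof. by move=> Xx; exists (mkseq x n); rewrite ?map_mkseq// wcons_mkseq. Qed.

(** In [Zw_cat_ge], [Cm * Cm] is the cost of restricting to compatible words in the window; the rest
    is the constant of [Zw_le_word]. *)
Definition Cqm : R := Cm * Cm * (card * (Cm * expR K)).

Lemma Cqm_gt0 : 0 < Cqm.
Proof.
have C0 : 0 < Cm by exact: Cmix_gt0.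
apply: mulr_gt0; first exact: mulr_gt0.
by apply: mulr_gt0 card_gt0 _; exact: mulr_gt0 C0 (expR_gt0 K).
Qed.

(* The fibre over [y] contains a point, which makes some word over [u] compatible with
   some word over [v]; mixing over the first window of [v] then spreads this to all
   words over [v]. *)
Lemma Zw_cat_ge y n m : Y y -> (N < m)%N ->
  Zw (mkseq y n) * Zw (mkseq (iter n (@shift S') y) m) <= Cqm * Zw (mkseq y (n + m)).
Proof.
move=> [x Xx <-] Nm; rewrite mkseq_addn iter_shift_site_map.
set x1 := iter n _ x; have Xx1 : X x1 by exact: sft_iter.
set u := mkseq (site_map pi x) n.
rewrite -(subnKC Nm) mkseq_addn; set t := mkseq (site_map pi x1) N.+1.
set w := mkseq _ (m - N.+1).
(* The indicator of the points that some word above [u] can precede; it depends only on the first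
   letter. *)
pose f x := if `[< has_word u x >] then 1 else 0 : R.
have f0 x' : X x' -> 0 <= f x' by rewrite /f; case: ifP.
have f_head x' x'' : X x' -> X x'' -> x' 0%N = x'' 0%N -> f x' <= 1 * f x''.
  move=> Xx' Xx'' x0; rewrite mul1r /f; case: ifPn => [/asboolP[a au Xa]|_]; last by case: ifP.
  by rewrite ifT//; apply/asboolP; exists a => //; exact: sft_wcons_eq Xa.
have uf x' : X x' -> Zw u * f x' <= card * (Cm * expR K) * Lw u (fun=> 1) x'.
  move=> Xx'; rewrite /f; case: ifPn => [/asboolP ux'|_]; first by rewrite mulr1 Zw_le_word.
  rewrite mulr0; apply: mulr_ge0 _ (Lw1_ge0 _ _ _ Xx'); apply: mulr_ge0 (ltW card_gt0) _.
  by apply: mulr_ge0 _ (expR_ge0 K); exact/ltW/Cmix_gt0.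
have st : size t = N.+1 by rewrite size_mkseq.
have tf : expR (- (N.+1%:R * M)) <= Lw t f (iter N.+1 (@shift S) x1).
  have Xa : X (wcons (mkseq x1 N.+1) (iter N.+1 (@shift S) x1)) by rewrite wcons_mkseq.
  have := @Lw_ge_term _ _ _ _ pi phi _ _ _ f0 Xa.
  rewrite map_mkseq; apply: le_trans.
  have -> : f (wcons (mkseq x1 N.+1) (iter N.+1 (@shift S) x1)) = 1.
    by rewrite wcons_mkseq /f ifT//; apply/asboolP; exact: has_word_mkseq.
  by rewrite mulr1 size_mkseq; exact: (expR_birkhoff_ge phi_le).
(* Inserting the indicator loses only a constant: the orbit of [x] gives one compatible word in the
   window, and mixing carries this to [x']. *)
have tf1 x' : X x' -> Lw t (fun=> 1) x' <= Cm * Cm * Lw t f x'.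
  move=> Xx'; have [tx'|ntx'] := pselect (has_word t x'); last first.
    by rewrite !Lw_has_word// mulr0.
  apply: (@le_trans _ _ ((card * expR M) ^+ N.+1)).
    rewrite -[leRHS]mulr1 -st; exact: (@Lw_le_sup _ _ _ _ _ _ M).
  have -> : (card * expR M) ^+ N.+1 = Cm * expR (- (N.+1%:R * M)).
    by rewrite /Cmix -mulrA -expRD subrr expR0 mulr1.
  rewrite -mulrA ler_pM2l ?Cmix_gt0// -[Cm in leRHS]mulr1.
  by apply: le_trans tf _; apply: (Lw_window mixN phi_le) => //; exact: sft_iter.
rewrite {2}/Zw mulr_sumr /Zw mulr_sumr; apply: ler_sum => s _.
rewrite !Lw_cat -/(Zw u) -!Lw_scale; apply: Lw_mono => // x' Xx'.
apply: (@le_trans _ _ (Zw u * (Cm * Cm * Lw t f x'))).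
  by rewrite ler_wpM2l ?Zw_ge0// tf1.
have -> : Zw u * (Cm * Cm * Lw t f x') = Cm * Cm * Lw t (fun x => Zw u * f x) x'.
  by rewrite Lw_scale; ring.
have -> : Cqm * Lw t (Lw u (fun=> 1)) x' =
    Cm * Cm * Lw t (fun x => card * (Cm * expR K) * Lw u (fun=> 1) x) x'.
  by rewrite Lw_scale /Cqm; ring.
rewrite ler_wpM2l; last exact: Lw_mono.
  by [].
by rewrite mulr_ge0 ?ltW ?Cmix_gt0.
Qed.

Lemma Zw_gt0 n y : Y y -> 0 < Zw (mkseq y n).
Proof.
move=> [x Xx <-]; have Xn : X (iter n (@shift S) x) by exact: sft_iter.
have := Lw1_le_Zw (mkseq (site_map pi x) n) Xn.
have Xa : X (wcons (mkseq x n) (iter n (@shift S) x)) by rewrite wcons_mkseq.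
have := @Lw_ge_term _ _ _ _ pi phi _ (fun=> 1) _ (fun _ _ => ler01) Xa.
rewrite map_mkseq mulr1 => le1 /(le_trans le1) le2.
by rewrite -(pmulr_rgt0 _ (expR_gt0 K)) (lt_le_trans _ le2)// expR_gt0.
Qed.

End partition_function.

(** * The potential on the factor *)

Section potential.
Context {R : realType} {S S' : finPointedType}.
Variables (A : rel S) (pi : S -> S') (phi : fullshift S -> R).
Implicit Types (x : fullshift S) (y : fullshift S') (a : seq S) (u v : seq S').
Implicit Types (f g h : fullshift S -> R).

Local Notation X := (sft A).
Local Notation Y := (site_map pi @` X).
Local Notation Lw := (Lw A pi phi).
Local Notation ratio_var := (ratio_var A).
Local Notation ratio_osc := (ratio_osc A).

Variables (N : nat) (M K : R).
Hypothesis mixN : word_mixing A pi N.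
Hypothesis M_ge0 : 0 <= M.
Hypothesis phi_le : forall x, X x -> `|phi x| <= M.
Hypothesis K_ge0 : 0 <= K.
Hypothesis bowenK : forall n x x', X x -> X x' -> agree n.+1 x x' ->
  `|birkhoff_sum n phi x - birkhoff_sum n phi x'| <= K.

Variable z : S -> fullshift S.
Hypothesis Xz : forall s, X (z s).
Hypothesis z_head : forall x, X x -> z (x 0%N) 0%N = x 0%N.

Local Notation Zw := (Zw A pi phi z).
Local Notation Cq := (@Cqm R S N M K).

Lemma Y_iter n y : Y y -> Y (iter n (@shift S') y).
Proof.
by move=> [x Xx <-]; rewrite iter_shift_site_map; eexists; [exact: sft_iter Xx|].
Qed.

Definition Zratio n m y : R :=
  ln (Zw (mkseq y (n + m)) / Zw (mkseq (iter n (@shift S') y) m)).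

Lemma Zw_pos n y : Y y -> 0 < Zw (mkseq y n).
Proof. by move=> Yy; exact: (Zw_gt0 bowenK Xz z_head). Qed.

Lemma Zratio_gt0 n m y : Y y ->
  0 < Zw (mkseq y (n + m)) / Zw (mkseq (iter n (@shift S') y) m).
Proof.
by move=> Yy; apply: divr_gt0; apply: Zw_pos => //; exact: Y_iter.
Qed.

Lemma Zratio_bounds n m y : Y y -> (N < m)%N ->
  Zw (mkseq y n) / Cq <= Zw (mkseq y (n + m)) / Zw (mkseq (iter n (@shift S') y) m)
    <= expR K * Zw (mkseq y n).
Proof.
move=> Yy Nm; have Zm := Zw_pos m (Y_iter n Yy); have C0 : 0 < Cq by exact: Cqm_gt0.
rewrite ler_pdivlMr// ler_pdivrMr//; apply/andP; split.
  rewrite mulrAC ler_pdivrMr// [leRHS]mulrC.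
  exact: (Zw_cat_ge mixN M_ge0 phi_le K_ge0 bowenK).
by rewrite mkseq_addn; exact: (Zw_cat_le _ bowenK).
Qed.

Lemma ln_Zratio_bounds n m y : Y y -> (N < m)%N ->
  ln (Zw (mkseq y n)) - ln Cq <= Zratio n m y <= K + ln (Zw (mkseq y n)).
Proof.
move=> Yy Nm; have /andP[lo hi] := Zratio_bounds n Yy Nm.
have Zn := Zw_pos n Yy; have Z0 := Zratio_gt0 n m Yy.
have C0 : 0 < Cq by exact: Cqm_gt0.
have e0 := expR_gt0 K.
apply/andP; split.
  by rewrite -ln_div ?posrE// ler_ln ?posrE// divr_gt0.
by rewrite -[K in leRHS]expRK -lnM ?posrE// ler_ln ?posrE// mulr_gt0.
Qed.

Lemma ln_dist (c a b : R) : 0 < c -> c <= a -> c <= b -> `|ln a - ln b| <= `|a - b| / c.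
Proof.
move=> c0; wlog ab : a b / b <= a.
  move=> H ca cb; have [ba|/ltW ab] := leP b a; first exact: H.
  by rewrite distrC [X in _ <= X / _]distrC; exact: H.
move=> ca cb; have b0 : 0 < b by exact: lt_le_trans cb.
have a0 : 0 < a by exact: lt_le_trans ca.
rewrite !ger0_norm ?subr_ge0// ?ler_ln ?posrE//.
rewrite -ln_div ?posrE//.
have -> : a / b = 1 + (a - b) / b by field; rewrite gt_eqF.
apply: (@le_trans _ _ ((a - b) / b)).
  by apply: le_ln1Dx; rewrite (lt_le_trans (ltrN10 _))// divr_ge0 ?subr_ge0// ltW.
by rewrite ler_wpM2l ?subr_ge0// lef_pV2 ?posrE.
Qed.

(** Dividing by [expR K * Zw u] puts the values in [0, 1], so the contraction estimates start from
    oscillation 1 for every [u]. *)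
Definition Lw1_class n : set (fullshift S -> R) :=
  [set g | exists u, [/\ size u = n, 0 < Zw u & g = fun x =>
    (expR K * Zw u)^-1 * Lw u (fun=> 1) x]].

Lemma Lw1_class_osc n g : Lw1_class n g -> ratio_osc g (fun=> 1) 1.
Proof.
move=> [u [_ Zu ->]]; exists 0 => x Xx; rewrite mul0r add0r mulr1.
have e0 := expR_gt0 K.
rewrite mulr_ge0 ?invr_ge0 ?mulr_ge0 ?(ltW e0) ?(ltW Zu)//=; last exact: Lw1_ge0.
rewrite ler_pdivrMl ?mulr_gt0// mulr1.
exact: (Lw1_le_Zw _ bowenK).
Qed.

Lemma Lw1_class_var n k E g : (0 < k)%N -> 0 <= E ->
  (forall x x', X x -> X x' -> agree (n + k) x x' ->
    `|birkhoff_sum n phi x - birkhoff_sum n phi x'| <= E) ->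
  Lw1_class n g -> ratio_var g (fun=> 1) k (expR E - 1).
Proof.
move=> k0 E0 HE Gg x x' Xx Xx' xx'; rewrite !mulr1.
have [al H] := Lw1_class_osc Gg.
have [u [su Zu gE]] := Gg.
have g1 : g x' <= 1.
  rewrite gE ler_pdivrMl ?mulr_gt0 ?expR_gt0// mulr1.
  exact: (Lw1_le_Zw _ bowenK).
have gx : g x <= expR E * g x'.
  rewrite gE mulrCA ler_pM2l ?invr_gt0 ?mulr_gt0 ?expR_gt0//.
  apply: Lw1_le => // [|a sa Xa Xa']; first exact: xx'.
  by rewrite su; apply: HE => //; rewrite -su -sa; exact: agree_wcons.
have e1 : 1 <= expR E by rewrite -expR0 ler_expR.
have : (expR E - 1) * g x' <= (expR E - 1) * 1 by rewrite ler_wpM2l// subr_ge0.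
lra.
Qed.

Definition osc_le n J e := forall g v, Lw1_class n g -> (J <= size v)%N ->
  ratio_osc (Lw v g) (Lw v (fun=> 1)) e.

(** [Z(uv) / Z(v)] is an average of values of [L_v (L_u 1) / L_v 1]. The interval containing these
    for the first [m] letters of [v] still contains them for longer [v]; the lower bound from
    quasi-multiplicativity turns its length into a bound on logarithms. *)
Lemma Zratio_dist_le n J e y m m' : osc_le n J e -> 0 <= e -> Y y ->
  (J <= m)%N -> (N < m)%N -> (m <= m')%N ->
  `|Zratio n m y - Zratio n m' y| <= e * (expR K * Cq).
Proof.
move=> osc_e e0 Yy Jm Nm mm'.
have C0 : 0 < Cq by exact: Cqm_gt0.
have eK0 := expR_gt0 K.
have Zn := Zw_pos n Yy.
set u := mkseq y n in Zn *; set W := expR K * Zw u.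
have W0 : 0 < W by rewrite mulr_gt0.
pose g x := W^-1 * Lw u (fun=> 1) x.
have Gg : Lw1_class n g by exists u; rewrite size_mkseq.
have [|al Hal] := osc_e g (mkseq (iter n (@shift S') y) m) Gg; first by rewrite size_mkseq.
have mulW b c : b * W * c = W * (b * c) by ring.
have between k : (m <= k)%N ->
  al * W <= Zw (mkseq y (n + k)) / Zw (mkseq (iter n (@shift S') y) k) <= (al + e) * W.
  move=> mk; have Zk := Zw_pos k (Y_iter n Yy).
  have osck x : X x -> al * Lw (mkseq (iter n (@shift S') y) k) (fun=> 1) x <=
      Lw (mkseq (iter n (@shift S') y) k) g x <=
      (al + e) * Lw (mkseq (iter n (@shift S') y) k) (fun=> 1) x.
    move=> Xx; rewrite -(subnKC mk) mkseq_addn 2!Lw_cat -!Lw_scale.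
    by apply/andP; split; apply: Lw_mono => // y' /Hal/andP[].
  have gE x : W * Lw (mkseq (iter n (@shift S') y) k) g x =
      Lw (mkseq y (n + k)) (fun=> 1) x.
    rewrite mkseq_addn Lw_cat -Lw_scale; congr Lw; apply/funext => x'.
    by rewrite mulrA mulfV ?mul1r// gt_eqF.
  rewrite ler_pdivlMr// ler_pdivrMr//; apply/andP; split.
    rewrite /Zw mulr_sumr; apply: ler_sum => s _.
    by rewrite -gE mulW ler_pM2l//; have /andP[] := osck _ (Xz s).
  rewrite /Zw mulr_sumr; apply: ler_sum => s _.
  by rewrite -gE mulW ler_pM2l//; have /andP[] := osck _ (Xz s).
have /andP[lo1 _] := Zratio_bounds n Yy Nm.
have /andP[lo2 _] := Zratio_bounds n Yy (leq_trans Nm mm').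
have c0 : 0 < Zw u / Cq by rewrite divr_gt0.
apply: (le_trans (ln_dist c0 lo1 lo2)).
rewrite ler_pdivrMr//.
have -> : e * (expR K * Cq) * (Zw u / Cq) = e * W by rewrite /W; field; rewrite gt_eqF.
have /andP[a1 a2] := between m (leqnn m); have /andP[b1 b2] := between m' mm'.
by rewrite ler_norml; apply/andP; split; lra.
Qed.

Definition psi y : R := lim (Zratio 1 m y @[m --> \oo]).

Hypothesis osc1_small : forall e, 0 < e -> exists J, osc_le 1 J e.

Lemma psi_cvg y : Y y -> Zratio 1 m y @[m --> \oo] --> psi y.
Proof.
move=> Yy; apply: (@cauchy_cvg _ (Zratio 1 ^~ y @ \oo)).
apply: cauchy_exP => e e0.
have C0 : 0 < expR K * Cq by rewrite mulr_gt0 ?expR_gt0 ?Cqm_gt0.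
have [J HJ] := osc1_small (divr_gt0 e0 (mulr_gt0 C0 (ltr0Sn R 1))).
exists (Zratio 1 (maxn J N.+1) y); exists (maxn J N.+1) => // m /= Jm.
apply: (@le_lt_trans _ _ (e / (expR K * Cq * 2) * (expR K * Cq))).
  apply: Zratio_dist_le HJ _ Yy _ _ Jm; rewrite ?leq_maxl ?leq_maxr//.
  by rewrite divr_ge0 ?ltW// mulr_gt0.
have -> : e / (expR K * Cq * 2) * (expR K * Cq) = e / 2 by field;
  rewrite !gt_eqF ?expR_gt0 ?Cqm_gt0.
by rewrite ltr_pdivrMr// ltr_pMr// ltr1n.
Qed.

(** Telescoping: the partition function of [y] without its first letter cancels. *)
Lemma ZratioS n m y : Y y ->
  Zratio n.+1 m y = Zratio 1 (n + m) y + Zratio n m (@shift S' y).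
Proof.
move=> Yy; have Ty : Y (@shift S' y) by exact: (Y_iter 1).
rewrite /Zratio -lnM ?posrE; first last.
- exact: Zratio_gt0.
- exact: Zratio_gt0.
rewrite add1n addSn iterSr /=; congr ln; field.
by rewrite !gt_eqF ?Zw_pos//; exact: Y_iter.
Qed.

Lemma birkhoff_psi_cvg n y : Y y -> Zratio n m y @[m --> \oo] --> birkhoff_sum n psi y.
Proof.
elim: n y => [|n IH] y Yy.
  rewrite birkhoff_sum0; apply: cvg_near_cst; near=> m.
  by rewrite /Zratio /= add0n divff ?ln1// gt_eqF// Zw_pos.
rewrite birkhoff_sumS (_ : Zratio n.+1 ^~ y = fun m =>
  Zratio 1 (n + m) y + Zratio n m (@shift S' y)).
  apply: cvgD; last by apply: IH; exact: (Y_iter 1).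
  rewrite (_ : (fun m => _) = fun m => Zratio 1 (m + n)%N y); last by apply/funext => m;
    rewrite addnC.
  by rewrite (cvg_shiftn n (Zratio 1 ^~ y)); exact: psi_cvg.
by apply/funext => m; exact: ZratioS.
Unshelve. all: by end_near. Qed.

(** The limit of [ln_Zratio_bounds]. Both the Gibbs property and the Bowen bound for [psi] rest on
    it. *)
Lemma birkhoff_psi_bounds n y : Y y ->
  ln (Zw (mkseq y n)) - ln Cq <= birkhoff_sum n psi y <= K + ln (Zw (mkseq y n)).
Proof.
move=> Yy; have cv := @birkhoff_psi_cvg n _ Yy.
by apply/andP; split; [apply: (cvgr_to_ge cv)|apply: (cvgr_to_le cv)];
  exists N.+1 => // m /= Nm; have /andP[] := ln_Zratio_bounds n Yy Nm.
Qed.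

Lemma birkhoff_psi_near n J e y m : osc_le n J e -> 0 <= e -> Y y ->
  (J <= m)%N -> (N < m)%N -> `|birkhoff_sum n psi y - Zratio n m y| <= e * (expR K * Cq).
Proof.
move=> osc_e e0 Yy Jm Nm; have cv := @birkhoff_psi_cvg n _ Yy.
have bnd k : (m <= k)%N -> `|Zratio n m y - Zratio n k y| <= e * (expR K * Cq).
  exact: Zratio_dist_le osc_e e0 Yy Jm Nm.
rewrite ler_distl; apply/andP; split; [apply: (cvgr_to_ge cv)|apply: (cvgr_to_le cv)];
  by exists m => // k /= mk; have := bnd k mk; rewrite ler_distlC => /andP[].
Qed.

Lemma mkseq_agree_Zratio n m y y' : agree (n + m) y y' -> Zratio n m y = Zratio n m y'.
Proof.
move=> yy'; rewrite /Zratio (iffLR (agree_mkseq _ _ _) yy').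
by congr (ln (_ / Zw _)); apply/agree_mkseq; exact: agree_iter.
Qed.

(** Both Birkhoff sums are close to [Zratio n m], which depends on the first [n + m] letters
    only. *)
Lemma birkhoff_psi_dist_le n J e y y' m : osc_le n J e -> 0 <= e -> Y y -> Y y' ->
  (J <= m)%N -> (N < m)%N -> agree (n + m) y y' ->
  `|birkhoff_sum n psi y - birkhoff_sum n psi y'| <= 2 * (e * (expR K * Cq)).
Proof.
move=> osc_e e0 Yy Yy' Jm Nm yy'.
have := birkhoff_psi_near osc_e e0 Yy Jm Nm.
have := birkhoff_psi_near osc_e e0 Yy' Jm Nm.
rewrite (mkseq_agree_Zratio yy') !ler_norml => /andP[? ?] /andP[? ?].
by apply/andP; split; lra.
Qed.

Lemma birkhoff_psi_bowen n y y' : Y y -> Y y' -> agree n y y' ->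
  `|birkhoff_sum n psi y - birkhoff_sum n psi y'| <= K + ln Cq.
Proof.
move=> Yy Yy' /agree_mkseq yy'.
have := birkhoff_psi_bounds n Yy; have := birkhoff_psi_bounds n Yy'.
rewrite yy' ler_norml => /andP[? ?] /andP[? ?].
by apply/andP; split; lra.
Qed.

End potential.

(** * Topology of the shift space *)

Section cylinder_topology.
Context {S : finPointedType}.
Implicit Types (x : fullshift S).

Lemma nbhs_agree x k : nbhs x [set x' | agree k x x'].
Proof.
elim: k => [|k IH]; first by apply: filterS filterT => x' _ i.
have cpk : {for x, continuous (fun y : fullshift S => y k : discrete_topology S)}.
  exact: (@proj_continuous nat (fun=> discrete_topology S) k x).
have nx : nbhs x [set y : fullshift S | y k = x k].
  exact: cpk (discrete_set1 (x k : discrete_topology S)).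
apply: filterS (filterI IH nx) => x' [/= xx' xk] i.
by rewrite ltnS leq_eqVlt => /predU1P[->//|]; exact: xx'.
Qed.

(** The filter generated by the cylinders around [x] converges to [x] in each coordinate, hence in
    the product topology. *)
Lemma nbhs_cylinder x (U : set (fullshift S)) :
  nbhs x U -> exists k, forall x', agree k x x' -> U x'.
Proof.
pose F : set_system (fullshift S) := [set U | exists k, forall x', agree k x x' -> U x'].
have FF : Filter F.
  split; first by exists 0%N.
  - move=> P Q [k Pk] [l Ql]; exists (maxn k l) => x' xx'.
    by split; [apply: Pk|apply: Ql]; apply: agree_leq xx'; rewrite ?leq_maxl ?leq_maxr.
  - by move=> P Q PQ [k Pk]; exists k => x' /Pk /PQ.
suff : F --> x by apply.
apply/(cvg_sup _ x) => i V [W [[W' oW' <-]] Wx WV].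
exists i.+1 => x' xx'; apply: WV; move: Wx => /=.
by rewrite (xx' i).
Qed.

Lemma open_prefix k (P : seq S -> Prop) : open [set x : fullshift S | P (mkseq x k)].
Proof.
rewrite openE => x /= Px; rewrite /interior; apply: filterS (nbhs_agree x k) => x' /= xx'.
by move/agree_mkseq : xx' => <-.
Qed.

Lemma measurable_open (U : set (fullshift S)) : open U -> measurable U.
Proof. exact: sub_sigma_algebra. Qed.

Lemma closed_sft (A : rel S) : closed (sft A).
Proof.
have -> : sft A = \bigcap_(i in setT) [set x : fullshift S | A (x i) (x i.+1)].
  by apply/seteqP; split=> x Xx i; [move=> _; exact: Xx|exact: (Xx i I)].
apply: closed_bigI => i _.
rewrite -[X in closed X]setCK; apply: open_closedC.
rewrite openE => x /= Ax; rewrite /interior.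
apply: filterS (nbhs_agree x i.+2) => x' /= xx'.
by rewrite -(xx' i)// -(xx' i.+1).
Qed.

Lemma compact_sft (A : rel S) : compact (sft A).
Proof.
apply: (subclosed_compact (@closed_sft A) _ (@subsetT _ _)).
have cS : compact (setT : set (discrete_topology S)).
  by apply: finite_compact; exact: (@finite_finset S setT).
have := @tychonoff nat (fun=> discrete_topology S) (fun=> setT) (fun=> cS).
by congr (compact _); apply/seteqP; split.
Qed.

Lemma hausdorff_fullshift : hausdorff_space (fullshift S).
Proof.
exact: (@hausdorff_product nat (fun=> discrete_topology S) (fun=> discrete_hausdorff)).
Qed.

Lemma measurable_sft (A : rel S) : measurable (sft A).
Proof.
rewrite -[sft A]setCK; apply: measurableC; apply: measurable_open.
exact/closed_openC/closed_sft.
Qed.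

Lemma uniformly_continuous_sft (R : realType) (A : rel S) (phi : fullshift S -> R) (e : R) :
  {within sft A, continuous phi} -> 0 < e ->
  exists k, forall x x', sft A x -> sft A x' -> agree k x x' -> `|phi x - phi x'| <= e.
Proof.
move=> /subspace_continuousP cphi e0.
(* Membership in [O k] depends on the first [k] letters, so [O k] is open; continuity makes these
   sets cover the compact shift, and the largest index of a finite subcover is the required
   length. *)
pose O k := [set x : fullshift S | forall w w', sft A w -> sft A w' ->
  mkseq w k = mkseq x k -> mkseq w' k = mkseq x k -> `|phi w - phi w'| <= e].
have oO k : open (O k).
  exact: (@open_prefix k (fun v => forall w w', sft A w -> sft A w' ->
    mkseq w k = v -> mkseq w' k = v -> `|phi w - phi w'| <= e)).
have : compact (sft A) by exact: compact_sft.
rewrite compact_cover => /(_ nat setT O (fun k _ => oO k))[].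
  move=> x Xx; have e20 : 0 < e / 2 by rewrite divr_gt0.
  have := cphi x Xx; move=> /cvgr_dist_le /(_ _ e20).
  rewrite /= => /nbhs_cylinder[k Hk]; exists k => // w w' Xw Xw' wx w'x.
  have := Hk w (iffRL (agree_mkseq _ _ _) (esym wx)) Xw.
  have := Hk w' (iffRL (agree_mkseq _ _ _) (esym w'x)) Xw'.
  rewrite /from_subspace /= !ler_norml => /andP[? ?] /andP[? ?]; apply/andP; split; lra.
move=> D _ XD; exists (\max_(k <- finmap.enum_fset D) k) => x x' Xx Xx' xx'.
have [k /= kD Okx] := XD x Xx; apply: Okx => //; apply/agree_mkseq.
apply: agree_sym; apply: agree_leq xx'.
by apply: (@leq_bigmax_seq _ _ (fun=> true) id).
Qed.

End cylinder_topology.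

Lemma measurable_site_image (S S' : finPointedType) (f : S -> S') (A : rel S) :
  measurable (site_map f @` sft A).
Proof.
rewrite -[X in measurable X]setCK; apply: measurableC; apply: measurable_open.
apply/closed_openC/(compact_closed (@hausdorff_fullshift S')).
apply: continuous_compact; last exact: compact_sft.
by apply: continuous_subspaceT => x; exact: continuous_site_map.
Qed.

(** * Measures of cylinders of the factor *)

Section gibbs_factor.
Context {R : realType} {S S' : finPointedType}.
Variables (A : rel S) (pi : S -> S') (phi : fullshift S -> R).
Variable mu : probability (fullshift S) R.
Implicit Types (x : fullshift S) (y : fullshift S') (b : seq S) (u : seq S').
Implicit Types (F : set (fullshift S)).

Local Notation X := (sft A).
Local Notation Y := (site_map pi @` X).
Local Notation Lw := (Lw A pi phi).
Local Notation pm F := (fine (mu F)).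

Lemma pmE F : measurable F -> mu F = (pm F)%:E.
Proof. by move=> mF; rewrite fineK// fin_num_measure. Qed.

Lemma pm_ge0 F : 0 <= pm F.
Proof. exact: fine_ge0. Qed.

Lemma pm_split F i : measurable F ->
  pm F = \sum_(s : S) pm (F `&` [set x | x i = s]).
Proof.
move=> mF; have mFi s : measurable (F `&` [set x | x i = s]).
  apply: measurableI => //; apply: measurable_open.
  rewrite openE => x /= xi; rewrite /interior; apply: filterS (nbhs_agree x i.+1) => x' /= xx'.
  by rewrite -xi -xx'.
rewrite sum_fine; last by move=> s _; rewrite fin_num_measure.
congr fine; rewrite fsbig_seq ?index_enum_uniq//.
rewrite -measure_fin_bigcup//.
- congr (mu _); apply/seteqP; split=> [x Fx|x [s _ [] //]].
  by exists (x i) => //=; exact: mem_index_enum.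
- by move=> s t _ _ [x [[_ /= <-] [_ <-]]].
Qed.

(** A family between the cylinders of the source ([u] empty) and the preimages of cylinders of the
    factor ([b] empty), which allows induction letter by letter. *)
Definition word_fibre u b := [set x | [/\ X x, map pi (mkseq x (size u)) = u &
  mkseq (iter (size u) (@shift S) x) (size b) = b]].

Lemma measurable_word_fibre u b : measurable (word_fibre u b).
Proof.
rewrite (_ : word_fibre u b = X `&` [set x | (fun w => map pi (take (size u) w) = u /\
  drop (size u) w = b) (mkseq x (size u + size b))]).
  apply: measurableI; first exact: measurable_sft.
  apply: measurable_open.
  exact: (@open_prefix S (size u + size b) (fun w => map pi (take (size u) w) =
    u /\ drop (size u) w = b)).
apply/seteqP; split=> x /=; rewrite mkseq_addn take_size_cat ?drop_size_cat ?size_mkseq//.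
  by case.
by move=> [? []].
Qed.

Lemma word_fibre_rcons u s b t :
  word_fibre (rcons u s) b `&` [set x | x (size u) = t] =
  if pi t == s then word_fibre u (t :: b) else set0.
Proof.
have mkS x : mkseq (iter (size u) (@shift S) x) (size b).+1 =
    x (size u) :: mkseq (iter (size u).+1 (@shift S) x) (size b).
  by rewrite -add1n mkseq_addn /= iter_shiftE addn0.
apply/seteqP; split=> x.
  move=> [[Xx ux bx] xt]; have {}xt : x (size u) = t by [].
  rewrite size_rcons mkseqS map_rcons in ux; rewrite size_rcons in bx.
  move: ux => /rcons_inj[ux xs]; have E := mkS x; rewrite xt bx in E.
  by rewrite -xs xt eqxx; split.
case: eqP => // ts [Xx ux bx]; have := mkS x; rewrite [LHS]bx => -[xt {}bx].
split; last by rewrite /= -xt.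
by split; rewrite ?size_rcons// mkseqS map_rcons ux -xt ts.
Qed.

Variables (C P : R).
Hypothesis C_gt0 : 0 < C.
Hypothesis gibbs : forall x n, X x -> (0 < n)%N ->
  ((C^-1)%:E <= mu (cylinder X (mkseq x n)) /
     (expR (- (n%:R * P) + birkhoff_sum n phi x))%:E <= C%:E)%E.

Lemma word_fibre_nil b : word_fibre [::] b = cylinder X b.
Proof. by apply/seteqP; split=> x [? ?]. Qed.

Lemma gibbs_cylinder x n : X x -> (0 < n)%N ->
  C^-1 * expR (- (n%:R * P) + birkhoff_sum n phi x) <= pm (cylinder X (mkseq x n))
    <= C * expR (- (n%:R * P) + birkhoff_sum n phi x).
Proof.
move=> Xx n0; have := gibbs Xx n0.
rewrite pmE; last by rewrite -word_fibre_nil; exact: measurable_word_fibre.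
by rewrite inver gt_eqF ?expR_gt0// -EFinM !lee_fin ler_pdivlMr ?ler_pdivrMr ?expR_gt0.
Qed.

(** The measure of [word_fibre u b] that the Gibbs property predicts: the weights of all lifts of
    [u] followed by [b], with tail [z]. *)
Definition word_weight u b z := expR (- ((size u + size b)%:R * P)) *
  expR (birkhoff_sum (size b) phi (wcons b z)) * Lw u (fun=> 1) (wcons b z).

(** Splitting by the lift of the last letter of [u] moves that letter into [b]; with [u] empty the
    claim is the Gibbs property. A lift that cannot precede [b] gives an empty fibre. *)
Lemma word_fibre_bounds u b z : b != [::] -> X (wcons b z) ->
  C^-1 * word_weight u b z <= pm (word_fibre u b) <= C * word_weight u b z.
Proof.
elim/last_ind: u b => [|u s IH] b b0 Xb.
  have := gibbs_cylinder Xb; rewrite -size_eq0 -lt0n in b0.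
  move=> /(_ _ b0); rewrite mkseq_wcons word_fibre_nil /word_weight /= mulr1 add0n.
  by rewrite expRD.
rewrite (pm_split (size u) (measurable_word_fibre _ _)).
have wE : word_weight (rcons u s) b z = \sum_(t : S)
    if (pi t == s) && A t (wcons b z 0%N) then word_weight u (t :: b) z else 0.
  rewrite -big_mkcond /word_weight Lw_rcons /Lop mulr_sumr; apply: eq_bigr => t _.
  rewrite size_rcons [size (t :: b)]/= addSnnS birkhoff_sumS /= expRD.
  by ring.
have bnd t : C^-1 * (if (pi t == s) && A t (wcons b z 0%N) then word_weight u (t :: b) z else 0)
    <= pm (word_fibre (rcons u s) b `&` [set x | x (size u) = t]) <=
    C * (if (pi t == s) && A t (wcons b z 0%N) then word_weight u (t :: b) z else 0).
  rewrite word_fibre_rcons; case: ifP => [/andP[ts At]|].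
    by rewrite ts; apply: IH => //; apply/sft_scons.
  move=> tsA; rewrite (_ : (if _ then _ else _) = set0); first by rewrite measure0 !mulr0 lexx.
  move: tsA; case: ifP => //= ts tA; apply/seteqP; split=> // x [Xx _ /= xtb].
  move: tA; case: b b0 Xb xtb {wE} => // c b' _ _ /=.
  rewrite /mkseq /= !iter_shiftE => -[<- <- _] /negP; apply.
  by rewrite addn0 addn1; exact: Xx.
rewrite wE !mulr_sumr; apply/andP; split; apply: ler_sum => t _.
  by have /andP[] := bnd t.
by have /andP[] := bnd t.
Qed.

Variables (M : R) (z : S -> fullshift S).
Hypothesis phi_le : forall x, X x -> `|phi x| <= M.
Hypothesis Xz : forall s, X (z s).
Hypothesis z_head : forall x, X x -> z (x 0%N) 0%N = x 0%N.

Local Notation Zw := (Zw A pi phi z).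

Lemma word_weight1 u x : X x ->
  expR (- (`|P| + M)) * (expR (- ((size u)%:R * P)) * Lw u (fun=> 1) x)
    <= word_weight u [:: x 0%N] (@shift S x) <=
  expR (`|P| + M) * (expR (- ((size u)%:R * P)) * Lw u (fun=> 1) x).
Proof.
move=> Xx; rewrite /word_weight.
have -> : wcons [:: x 0%N] (@shift S x) = x by exact: scons_head.
rewrite [size [:: _]]/= birkhoff_sum1.
have -> : expR (- ((size u + 1)%:R * P)) = expR (- ((size u)%:R * P)) * expR (- P).
  by rewrite natrD -expRD; congr expR; ring.
have -> : expR (- ((size u)%:R * P)) * expR (- P) * expR (phi x) * Lw u (fun=> 1) x =
  expR (- P + phi x) * (expR (- ((size u)%:R * P)) * Lw u (fun=> 1) x).
  by rewrite expRD; ring.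
have w0 : 0 <= expR (- ((size u)%:R * P)) * Lw u (fun=> 1) x.
  by rewrite mulr_ge0 ?expR_ge0//; exact: Lw1_ge0.
have := phi_le Xx; rewrite ler_norml => /andP[p1 p2].
have := ler_norm P; have := ler_norm (- P); rewrite normrN => P1 P2.
by apply/andP; split; rewrite ler_wpM2r// ler_expR; lra.
Qed.

Definition Cfactor : R := #|S|%:R * C * expR (`|P| + M).

Lemma Cfactor_gt0 : 0 < Cfactor.
Proof. by rewrite !mulr_gt0 ?expR_gt0// ltr0n; apply/card_gt0P; exists point. Qed.

Lemma word_fibre_Zw u :
  Cfactor^-1 * (expR (- ((size u)%:R * P)) * Zw u) <= pm (word_fibre u [::]) <=
  Cfactor * (expR (- ((size u)%:R * P)) * Zw u).
Proof.
have split1 := pm_split (size u) (measurable_word_fibre u [::]).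
have fib1 s : word_fibre u [::] `&` [set x | x (size u) = s] = word_fibre u [:: s].
  apply/seteqP; split=> x; rewrite /word_fibre /= /mkseq /= iter_shiftE addn0.
    by move=> [[Xx ux _] ->].
  by move=> [Xx ux [xs]].
have e0 := expR_gt0 (- ((size u)%:R * P)).
have eM := expR_gt0 (`|P| + M).
have Z0 : 0 <= expR (- ((size u)%:R * P)) * Zw u.
  by rewrite mulr_ge0 ?expR_ge0//; apply: sumr_ge0 => s _; apply: Lw1_ge0.
have S1 : 1 <= #|S|%:R :> R by rewrite ler1n; apply/card_gt0P; exists point.
apply/andP; split.
  rewrite ler_pdivrMl ?Cfactor_gt0//.
  (* Reference points of different [s] may share a first letter, so each summand is compared with
     the whole fibre, at the cost of a factor [#|S|]. *)
  have -> : Cfactor * pm (word_fibre u [::]) =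
    \sum_(s : S) C * expR (`|P| + M) * pm (word_fibre u [::]).
    by rewrite sumr_const /Cfactor -!mulrA mulr_natl.
  rewrite /Zw mulr_sumr; apply: ler_sum => s _.
  have /andP[lo _] := word_weight1 u (Xz s).
  have Xw : X (wcons [:: z s 0%N] (@shift S (z s))) by rewrite /= scons_head.
  have /andP[wlo _] := @word_fibre_bounds u [:: z s 0%N] _ isT Xw.
  have le1 : pm (word_fibre u [:: z s 0%N]) <= pm (word_fibre u [::]).
    by rewrite split1 (bigD1 (z s 0%N))//= fib1 lerDl sumr_ge0// => t _; exact: pm_ge0.
  rewrite (expRN (`|P| + M)) ler_pdivrMl// in lo; rewrite ler_pdivrMl// in wlo.
  apply: (le_trans lo); rewrite mulrAC [leRHS]mulrC ler_pM2l//.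
  by apply: (le_trans wlo); rewrite ler_pM2l.
apply: (@le_trans _ _ (C * expR (`|P| + M) * (expR (- ((size u)%:R * P)) * Zw u))); last first.
  by rewrite /Cfactor ler_wpM2r// -mulrA ler_peMl// mulr_ge0 ?ltW.
rewrite split1 /Zw !mulr_sumr; apply: ler_sum => s _; rewrite fib1.
(* A letter that begins no point has an arbitrary reference point, but its fibre is empty. *)
have [[x [Xx xs]]|dead] := pselect (exists x, X x /\ x 0%N = s); last first.
  rewrite (_ : word_fibre u [:: s] = set0); last first.
    apply/seteqP; split=> // x; rewrite /word_fibre /= /mkseq /= => -[Xx _ [xs]]; apply: dead.
    by exists (iter (size u) (@shift S) x); split=> //; exact: sft_iter.
  rewrite measure0; apply: mulr_ge0; first by rewrite mulr_ge0 ?ltW.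
  by rewrite mulr_ge0 ?expR_ge0//; exact: Lw1_ge0.
have zs : z s 0%N = s by rewrite -xs z_head.
have Xw : X (wcons [:: s] (@shift S (z s))) by rewrite /= -[s in scons s]zs scons_head.
have /andP[_ whi] := @word_fibre_bounds u [:: s] _ isT Xw.
apply: (le_trans whi); rewrite -mulrA ler_pM2l// -{1}zs.
by have /andP[_] := word_weight1 u (Xz s).
Qed.

End gibbs_factor.

(** * Regularity classes *)

Section regularity_moduli.
Context {R : realType} {S : finPointedType}.
Implicit Types (X : set (fullshift S)) (phi : fullshift S -> R) (x : fullshift S).

Definition osc_on X n phi (c : R) :=
  forall x x', X x -> X x' -> agree n x x' -> `|phi x - phi x'| <= c.

Lemma var_leP X n phi c : (var X n phi <= c%:E)%E <-> osc_on X n phi c.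
Proof.
split=> [H x x' Xx Xx' xx'|H].
  by rewrite -lee_fin; apply: le_trans H; apply: ereal_sup_ubound; exists (x, x').
by apply: ge_ereal_sup => _ [[x x'] [/= Xx Xx' xx'] <-]; rewrite lee_fin; exact: H.
Qed.

Lemma var_ge0 X n phi : X !=set0 -> (0 <= var X n phi)%E.
Proof.
move=> [x Xx]; apply: ereal_sup_ubound; exists (x, x) => //=.
by rewrite subrr normr0.
Qed.

(** There are finitely many words of length [m]; each that occurs gets a representative point, and
    every value of [phi] is within [c] of one of theirs. *)
Lemma osc_on_bounded X m phi c : osc_on X m phi c ->
  exists M, 0 <= M /\ forall x, X x -> `|phi x| <= M.
Proof.
move=> osc_c.
have [p Hp] : exists p : m.-tuple S -> fullshift S, forall x (w : m.-tuple S), X x ->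
    mkseq x m = w -> X (p w) /\ mkseq (p w) m = w.
  have /choice[p Hp] : forall w : m.-tuple S, exists y : fullshift S, forall x, X x ->
      mkseq x m = w -> X y /\ mkseq y m = w.
    move=> w; have [[y Hy]|nex] := pselect (exists y, X y /\ mkseq y m = w).
      by exists y => x _ _.
    by exists point => x Xx xw; case: nex; exists x.
  by exists p => x w; exact: Hp.
exists (`|c| + \sum_(w : m.-tuple S) `|phi (p w)|); split.
  by rewrite addr_ge0// sumr_ge0.
move=> x Xx; have sx : size (mkseq x m) == m by rewrite size_mkseq.
have [Xp px] := Hp x (Tuple sx) Xx erefl.
rewrite -[phi x](subrK (phi (p (Tuple sx)))) (le_trans (ler_normD _ _))// lerD//.
  by apply: (le_trans _ (ler_norm c)); apply: osc_c => //; apply/agree_mkseq.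
by rewrite (bigD1 (Tuple sx))//= lerDl sumr_ge0.
Qed.

Lemma osc_on_birkhoff X m phi e j : (forall x, X x -> X (@shift S x)) ->
  osc_on X m phi e -> osc_on X (j + m) (birkhoff_sum j phi) (j%:R * e).
Proof.
move=> XT osc_e; elim: j => [|j IH] x x' Xx Xx' xx'.
  by rewrite !birkhoff_sum0 subrr normr0 mul0r.
rewrite !birkhoff_sumS -[j.+1]add1n natrD mulrDl mul1r opprD addrACA.
rewrite (le_trans (ler_normD _ _))// lerD//.
  by apply: osc_e => //; apply: agree_leq xx'; rewrite leq_addl.
by apply: IH; [exact: XT|exact: XT|move=> i ij; apply: xx'; rewrite addSn ltnS].
Qed.

Lemma holder_birkhoff X phi (c th : R) j k : 0 <= c -> 0 < th < 1 ->
  (forall x, X x -> X (@shift S x)) -> (forall n, osc_on X n phi (c * th ^+ n)) ->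
  osc_on X (j + k) (birkhoff_sum j phi) (c / (1 - th) * th ^+ k).
Proof.
move=> c0 /andP[th0 th1] XT Hc.
have d0 : 0 < 1 - th by rewrite subr_gt0.
(* The partial geometric sum, rather than its limit, is what the induction on [j] preserves. *)
suff main : osc_on X (j + k) (birkhoff_sum j phi) (c / (1 - th) * th ^+ k * (1 - th ^+ j)).
  move=> x x' Xx Xx' xx'; apply: (le_trans (main _ _ Xx Xx' xx')).
  rewrite ler_piMr//; first by rewrite !mulr_ge0 ?invr_ge0 ?exprn_ge0// ltW.
  by rewrite gerBl exprn_ge0// ltW.
elim: j => [|j IH] x x' Xx Xx' xx'.
  by rewrite !birkhoff_sum0 subrr normr0 expr0 subrr mulr0.
rewrite !birkhoff_sumS opprD addrACA (le_trans (ler_normD _ _))//.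
have H1 := Hc _ x x' Xx Xx' xx'.
have H2 : agree (j + k) (@shift S x) (@shift S x').
  by move=> i ij; apply: xx'; rewrite addSn ltnS.
have {H2}IH := IH _ _ (XT _ Xx) (XT _ Xx') H2.
apply: (le_trans (lerD H1 IH)).
have -> : c / (1 - th) * th ^+ k * (1 - th ^+ j.+1) =
  c * th ^+ k * th ^+ j + c / (1 - th) * th ^+ k * (1 - th ^+ j).
  by rewrite exprS; field; rewrite gt_eqF.
rewrite lerD2r -mulrA -exprD ler_wpM2l//.
by apply: ler_wiXn2l; rewrite ?ltW// addSn addnC leqnSn.
Qed.

Lemma continuous_of_osc_on X phi :
  (forall e, 0 < e -> exists k, osc_on X k phi e) -> {within X, continuous phi}.
Proof.
move=> H; apply/subspace_continuousP => x Xx; apply/cvgrPdist_le => e e0.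
have [k Hk] := H e e0; apply: filterS (nbhs_agree x k) => x' /= xx' Xx'.
exact: Hk.
Qed.

(** Convergence to 0 in the extended reals is eventual finiteness together with convergence of the
    real values; nonemptiness of [X] makes the suprema nonnegative. *)
Lemma is_waltersP X phi : X !=set0 ->
  is_walters X phi <-> forall e, 0 < e -> exists k0, forall k n, (k0 <= k)%N -> (0 < n)%N ->
    osc_on X (n + k) (birkhoff_sum n phi) e.
Proof.
move=> X0; rewrite /is_walters; set f := (fun k => _).
have f0 k : (0 <= f k)%E.
  apply: (le_trans (var_ge0 (1 + k) (birkhoff_sum 1 phi) X0)).
  by apply: ereal_sup_ubound; exists 1%N.
have fP k e : (f k <= e%:E)%E <-> forall n, (0 < n)%N ->
  osc_on X (n + k) (birkhoff_sum n phi) e.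
  split=> [fe n n0|H].
    by apply/var_leP; apply: le_trans fe; apply: ereal_sup_ubound; exists n.
  by apply: ge_ereal_sup => _ [n n0 <-]; apply/var_leP; exact: H.
split=> [/fine_cvgP[[k1 _ fin] /cvgr0_norm_le cv] e e0|H].
  have [k2 _ Hk2] := cv e e0; exists (maxn k1 k2) => k n kk.
  move: n; apply/fP; rewrite -(@fineK _ (f k)).
    rewrite lee_fin; apply: (le_trans (ler_norm _)); apply: Hk2 => /=.
    exact: leq_trans (leq_maxr _ _) kk.
  by apply: fin => /=; exact: leq_trans (leq_maxl _ _) kk.
apply/fine_cvgP; split.
  have [k0 Hk0] := H 1 ltr01; exists k0 => // k /= kk.
  rewrite fin_numElt (lt_le_trans _ (f0 k)) ?ltNy0//=.
  by apply: (@le_lt_trans _ _ 1%:E); rewrite ?ltry//; apply/fP => n; exact: Hk0.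
apply/cvgrPdist_le => e e0; have [k0 Hk0] := H e e0; exists k0 => // k /= kk.
rewrite sub0r normrN ger0_norm ?fine_ge0//.
have fe : (f k <= e%:E)%E by apply/fP => n; exact: Hk0.
rewrite -lee_fin fineK// fin_numElt (lt_le_trans _ (f0 k)) ?ltNy0//=.
by apply: (le_lt_trans fe); rewrite ltry.
Qed.

End regularity_moduli.

(** * The image measure on the factor *)

Section factor_measure.
Context {R : realType} {S S' : finPointedType}.
Variables (A : rel S) (pi : S -> S') (mu : probability (fullshift S) R).

Local Notation X := (sft A).
Local Notation Y := (site_map pi @` X).
Local Notation nu := (distribution mu (site_map pi)).

Hypothesis muX : mu X = 1%E.

Lemma measurable_preimage_site_map (E : set (fullshift S')) :
  measurable E -> measurable (site_map pi @^-1` E).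
Proof. by move=> mE; rewrite -[X in measurable X]setTI; exact: measurable_site_map. Qed.

Lemma mu_setIX (E : set (fullshift S)) : measurable E -> mu (E `&` X) = mu E.
Proof.
move=> mE; have mX := @measurable_sft S A.
have muC : mu (~` X) = 0%E by rewrite probability_setC// muX subee.
have mI : measurable (E `&` X) by exact: measurableI.
have mD : measurable (E `\` X) by exact: measurableD.
rewrite -[in RHS](setUIDK E X) measureU//; last first.
  by apply/seteqP; split=> // x [[_ Xx] [_ /(_ Xx)]].
rewrite [X in (_ + X)%E](_ : _ = 0%E) ?adde0//.
apply/eqP; rewrite eq_le measure_ge0 andbT -muC le_measure ?inE//.
exact: measurableC.
Qed.

Lemma measurable_cylinder_image (u : seq S') : measurable (cylinder Y u).
Proof.
rewrite (_ : cylinder Y u = Y `&` [set y | mkseq y (size u) = u]); last by apply/seteqP; split.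
apply: measurableI; first exact: measurable_site_image.
by apply: measurable_open; exact: (@open_prefix _ (size u) (fun w => w = u)).
Qed.

(** The preimage of the cylinder and the word fibre differ only outside [X], a null set. *)
Lemma distribution_cylinder (u : seq S') :
  nu (cylinder Y u) = mu (word_fibre A pi u [::]).
Proof.
rewrite /distribution /pushforward -mu_setIX; last first.
  by apply: measurable_preimage_site_map; exact: measurable_cylinder_image.
congr (mu _); apply/seteqP; split=> x.
  by move=> [[_ xu] Xx]; split=> //; rewrite map_mkseq.
move=> [Xx xu _]; split=> //; split; first by exists x.
by rewrite /= -map_mkseq.
Qed.

Lemma distribution_image : nu Y = 1%E.
Proof.
apply/eqP; rewrite eq_le probability_le1//=; last exact: measurable_site_image.
rewrite -[leLHS]muX /distribution /pushforward le_measure ?inE//.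
- exact: measurable_sft.
- by apply: measurable_preimage_site_map; exact: measurable_site_image.
- by move=> x Xx; exists x.
Qed.

Lemma distribution_shift_invariant : shift_invariant mu -> shift_invariant nu.
Proof.
move=> inv E mE; rewrite /distribution /pushforward.
exact: (inv (site_map pi @^-1` E) (measurable_preimage_site_map mE)).
Qed.

End factor_measure.

(** * Gibbs property and regularity of the factor potential *)

Section factor_potential.
Context {R : realType} {S S' : finPointedType}.
Variables (A : rel S) (pi : S -> S') (phi : fullshift S -> R).
Variable mu : probability (fullshift S) R.

Local Notation X := (sft A).
Local Notation Y := (site_map pi @` X).
Local Notation nu := (distribution mu (site_map pi)).

Hypothesis gibbs : is_gibbs X phi mu.
Hypothesis mixX : fiberwise_subpositive_mixing X pi.

Lemma X_neq0 : X !=set0.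
Proof.
have [muX _ _] := gibbs; apply/set0P/negP => /eqP X0.
by move: muX; rewrite X0 measure0 => /esym/eqP; rewrite onee_eq0.
Qed.

Lemma reference_points : exists z : S -> fullshift S,
  (forall s, X (z s)) /\ forall x, X x -> z (x 0%N) 0%N = x 0%N.
Proof.
have [x0 Xx0] := X_neq0.
have /choice[z Hz] : forall s : S, exists y, X y /\ forall x, X x -> x 0%N = s -> y 0%N = s.
  move=> s; have [[y [Xy ys]]|nex] := pselect (exists y, X y /\ y 0%N = s).
    by exists y.
  by exists x0; split=> // x Xx xs; case: nex; exists x.
exists z; split=> [s|x Xx]; first by case: (Hz s).
by have [_ H] := Hz (x 0%N); exact: (H x).
Qed.

Lemma Y_neq0 : Y !=set0.
Proof. by have [x Xx] := X_neq0; exists (site_map pi x); exists x. Qed.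

Variable K : R.
Hypothesis phi_uc : forall e, 0 < e -> exists k, osc_on X k phi e.
Hypothesis bowenK : forall n, osc_on X n.+1 (birkhoff_sum n phi) K.

(** One [psi] serves all three classes. Uniform continuity and the Bowen bound are common to them;
    the stronger moduli enter only through the two implications. *)
Lemma factor_potential_exists : exists psi : fullshift S' -> R,
  [/\ is_gibbs Y psi nu, is_bowen Y psi,
    (forall e, 0 < e -> exists k0, forall k n, (k0 <= k)%N -> (0 < n)%N ->
      osc_on X (n + k) (birkhoff_sum n phi) e) -> is_walters Y psi
    & (exists c th, [/\ 0 <= c, 0 < th < 1 & forall j k,
      osc_on X (j + k) (birkhoff_sum j phi) (c * th ^+ k)]) -> is_holder Y psi].
Proof.
have [N mixN] := fiberwise_word_mixing mixX.
have [z [Xz z_head]] := reference_points.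
have [k1 Hk1] := phi_uc ltr01.
have [M [M0 phi_le]] := osc_on_bounded Hk1.
have XT (x : fullshift S) : X x -> X (@shift S x) by exact: (@sft_iter _ A 1).
have K0 : 0 <= K.
  have [x Xx] := X_neq0; have := @bowenK 0%N x x Xx Xx (fun i _ => erefl).
  by rewrite subrr normr0.
have bowenK' : forall n x x', X x -> X x' -> agree n.+1 x x' ->
  `|birkhoff_sum n phi x - birkhoff_sum n phi x'| <= K by exact: bowenK.
have phiU j e : 0 < e -> exists k, forall x x', X x -> X x' -> agree (j + k) x x' ->
    `|birkhoff_sum j phi x - birkhoff_sum j phi x'| <= e.
  move=> e0; have [k Hk] := phi_uc (divr_gt0 e0 (ltr0Sn R j)).
  exists k => x x' Xx Xx' xx'.
  apply: (le_trans (osc_on_birkhoff XT Hk Xx Xx' xx')).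
  rewrite mulrCA ler_piMr ?(ltW e0)// ler_pdivrMr ?ltr0Sn// mul1r ler_nat.
  exact: leqnSn.
pose G n := Lw1_class A pi phi K z n.
(* [n0] is a set of word lengths over which the decay is uniform: length 1 for the existence and
   continuity of [psi], all positive lengths for the Walters property. *)
have class_small (n0 : set nat) : (forall e, 0 < e -> exists k0, forall k n, (k0 <=
  k)%N -> n0 n ->
      osc_on X (n + k) (birkhoff_sum n phi) e) ->
    forall e, 0 < e -> exists J, forall n, n0 n -> osc_le A pi phi K z n J e.
  move=> Hn0 e e0.
  have [||J HJ] := @osc_small _ _ _ A pi phi N M K mixN M0 phi_le K0 bowenK'
    [set g | exists2 n, n0 n & G n g] phiU _ _ e e0.
  - by move=> g [n _ /Lw1_class_osc]; apply.
  - move=> e' e'0; have l0 : 0 < ln (1 + e') by rewrite ln_gt0// ltrDl.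
    have [k0 Hk0] := Hn0 _ l0; exists k0.+1 => g [n n0n Gg].
    have -> : e' = expR (ln (1 + e')) - 1 by rewrite lnK ?posrE ?addr_gt0//; ring.
    apply: (Lw1_class_var bowenK' Xz z_head _ (ltW l0) _ Gg) => // x x' Xx Xx' xx'.
    by apply: Hk0 xx' => //; exact: leqnSn.
  by exists J => n n0n g v Gg Jv; apply: HJ => //; exists n.
have osc1_small e : 0 < e -> exists J, osc_le A pi phi K z 1 J e.
  move=> e0; have [|J HJ] := class_small [set 1%N] _ e e0; last by exists J; exact: HJ.
  move=> e' e'0; have [k0 Hk0] := phi_uc e'0; exists k0 => k n kk -> x x' Xx Xx' xx'.
  by rewrite !birkhoff_sum1; apply: Hk0 => //; apply: agree_leq xx'; rewrite leqW.
pose psi := psi A pi phi z.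
pose W := expR K * @Cqm R S N M K.
have C0 : 0 < @Cqm R S N M K by exact: Cqm_gt0.
have W0 : 0 < W by rewrite mulr_gt0 ?expR_gt0.
have psi_dist n J e m : osc_le A pi phi K z n J e -> 0 <= e -> (J <= m)%N -> (N < m)%N ->
    osc_on Y (n + m) (birkhoff_sum n psi) (2 * (e * W)).
  move=> osc_e e0 Jm Nm y y' Yy Yy' yy'.
  exact: (birkhoff_psi_dist_le mixN M0 phi_le K0 bowenK' Xz z_head osc1_small osc_e e0 Yy
    Yy' Jm Nm yy').
have psi_bowen n : osc_on Y n (birkhoff_sum n psi) (K + ln (@Cqm R S N M K)).
  move=> y y' Yy Yy' yy'.
  exact: (birkhoff_psi_bowen mixN M0 phi_le K0 bowenK' Xz z_head osc1_small Yy Yy' yy').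
have small e : 0 < e -> 2 * (e / (2 * W) * W) = e by move=> e0; field; rewrite gt_eqF.
have [muX inv [C [P [C_gt0 gib]]]] := gibbs.
exists psi; split.
- split; [exact: distribution_image|exact: distribution_shift_invariant|].
  pose Cf := @Cfactor R S C P M; have Cf0 : 0 < Cf by exact: Cfactor_gt0.
  (* The sum [Cqm + expR K] dominates the constants of both comparisons [s1] and [s2]. *)
  pose D := Cf * (@Cqm R S N M K + expR K).
  have D0 : 0 < D by rewrite mulr_gt0// addr_gt0// expR_gt0.
  exists D, P; split=> // y n Yy n0.
  rewrite [X in (X / _)%E](_ : _ = mu (word_fibre A pi (mkseq y n) [::])); last first.
    exact: distribution_cylinder.
  rewrite pmE; last exact: measurable_word_fibre.
  rewrite inver gt_eqF ?expR_gt0// -EFinM !lee_fin ler_pdivlMr ?ler_pdivrMr ?expR_gt0//.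
  have := word_fibre_Zw pi C_gt0 gib phi_le Xz z_head (mkseq y n).
  rewrite size_mkseq -/Cf => /andP[lo hi].
  have Z0 := Zw_gt0 bowenK' Xz z_head n Yy.
  have := birkhoff_psi_bounds mixN M0 phi_le K0 bowenK' Xz z_head osc1_small n Yy.
  rewrite -/psi => /andP[slo shi].
  move: lo hi slo shi; rewrite expRD.
  move: (Zw A pi phi z _) Z0 => Z Z0 lo hi slo shi.
  have e0 := expR_gt0 (- (n%:R * P)).
  have s1 : Z <= @Cqm R S N M K * expR (birkhoff_sum n psi y).
    rewrite -ler_pdivrMl// -[leLHS]lnK ?posrE ?mulr_gt0 ?invr_gt0//.
    by rewrite ler_expR lnM ?lnV ?posrE ?invr_gt0//; lra.
  have s2 : expR (birkhoff_sum n psi y) <= expR K * Z.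
    by rewrite -[X in _ * X]lnK ?posrE// -expRD ler_expR.
  have sP := expR_gt0 (birkhoff_sum n psi y).
  apply/andP; split.
    apply: le_trans lo; rewrite ler_pdivrMl// /D.
    have -> : Cf * (@Cqm R S N M K + expR K) * (Cf^-1 * (expR (- (n%:R * P)) * Z)) =
      expR (- (n%:R * P)) * ((@Cqm R S N M K + expR K) * Z) by field; rewrite gt_eqF.
    rewrite ler_pM2l//; apply: (le_trans s2); rewrite ler_pM2r// lerDr ltW//.
  have -> : D * (expR (- (n%:R * P)) * expR (birkhoff_sum n psi y)) =
    Cf * (expR (- (n%:R * P)) * ((@Cqm R S N M K + expR K) * expR (birkhoff_sum n psi y))).
    by rewrite /D; ring.
  apply: (le_trans hi); rewrite (ler_pM2l Cf0) (ler_pM2l e0).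
  apply: (le_trans s1); rewrite ler_pM2r// lerDl expR_ge0//.
- split.
    apply: continuous_of_osc_on => e e0.
    have eW : 0 < e / (2 * W) by rewrite divr_gt0// mulr_gt0.
    have [J HJ] := osc1_small _ eW; exists (1 + maxn J N.+1)%N.
    have := psi_dist _ _ _ _ HJ (ltW eW) (leq_maxl J N.+1) (leq_maxr J N.+1).
    rewrite small// => H y y' Yy Yy' yy'.
    by have := H y y' Yy Yy' yy'; rewrite !birkhoff_sum1.
  exists (K + ln (@Cqm R S N M K)).
  by apply: ge_ereal_sup => _ [n _ <-]; apply/var_leP; exact: psi_bowen.
- move=> walt; apply/(is_waltersP _ Y_neq0) => e e0.
  have eW : 0 < e / (2 * W) by rewrite divr_gt0// mulr_gt0.
  have [|J HJ] := class_small [set n | (0 < n)%N] _ _ eW.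
    by move=> e' e'0; have [k0 Hk0] := walt e' e'0; exists k0.
  exists (maxn J N.+1) => k n Jk n0; rewrite -(small e e0).
  apply: psi_dist (HJ n n0) (ltW eW) _ _.
    exact: leq_trans (leq_maxl _ _) Jk.
  exact: leq_trans (leq_maxr _ _) Jk.
- move=> [c [th [c0 th01 Hc]]].
  (* The variation constant [c * expR c] comes from [expR t - 1 <= t * expR t] at [t = c * th ^+ k],
     where [th ^+ k <= 1]. *)
  have [||c' [r [c'0 /andP[r0 r1] Hr]]] :=
    @osc_expo _ _ _ A pi phi N M K mixN M0 phi_le K0 bowenK'
      (G 1%N) c (c * expR c) th c0 th01 Hc.
  - by move=> g /Lw1_class_osc; apply.
  - move=> g k Gg k0; have /andP[th0 th1] := th01.
    have thk : th ^+ k <= 1 by rewrite exprn_ile1 ?ltW.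
    have thk0 : 0 <= th ^+ k by rewrite exprn_ge0 ?ltW.
    have E0 : 0 <= c * th ^+ k by rewrite mulr_ge0.
    apply: (@ratio_var_le _ _ _ _ _ k _ (expR (c * th ^+ k) - 1)) => //.
      apply: (le_trans (expR_sub1_le _)); rewrite mulrAC ler_wpM2r//.
      by rewrite ler_wpM2l// ler_expR ler_piMr.
    apply: (Lw1_class_var bowenK' Xz z_head k0 E0 _ Gg) => x x' Xx Xx' xx'.
    exact: Hc.
  have osc_r J : osc_le A pi phi K z 1 J (c' * r ^+ J).
    move=> g v Gg Jv; apply: ratio_osc_le (Hr g v Gg); first exact: Lw1_ge0.
    by rewrite ler_pM2l// ler_wiXn2l ?ltW.
  have [B [B0 HB]] := osc_on_bounded (psi_bowen 1%N).
  (* The first summand covers [n <= N.+1], where only the bound [B] on [psi] is used; the second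
     covers longer agreement. *)
  exists (2 * B / r ^+ N.+1 + 2 * (c' * W) / r), r; split; first by rewrite r0 r1.
  have t1 : 0 <= 2 * B / r ^+ N.+1 by rewrite !mulr_ge0 ?invr_ge0 ?exprn_ge0// ltW.
  have t2 : 0 <= 2 * (c' * W) / r by rewrite !mulr_ge0 ?invr_ge0// ltW.
  move=> n; apply/var_leP => y y' Yy Yy' yy'; rewrite mulrDl.
  have rn : 0 < r ^+ n by rewrite exprn_gt0.
  have [nN|Nn] := leqP n N.+1.
    apply: (@le_trans _ _ (2 * B / r ^+ N.+1 * r ^+ n)); last first.
      by rewrite lerDl mulr_ge0 ?(ltW rn).
    apply: (@le_trans _ _ (2 * B)).
      have := HB y Yy; have := HB y' Yy'; rewrite !birkhoff_sum1 => b1 b2.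
      by rewrite (le_trans (ler_normB _ _))//; lra.
    rewrite mulrAC ler_pdivlMr ?exprn_gt0// ler_wpM2l ?mulr_ge0//.
    by apply: ler_wiXn2l; rewrite ?ltW.
  apply: (@le_trans _ _ (2 * (c' * W) / r * r ^+ n)); last first.
    by rewrite lerDr mulr_ge0 ?(ltW rn).
  (* Of the [n.+1] common letters one is used by [psi] itself and [n] by the decay, whence the
     division by [r]. *)
  case: n Nn yy' rn => // n Nn yy' rn.
  have e0 : 0 <= c' * r ^+ n by rewrite mulr_ge0 ?exprn_ge0 ?ltW.
  have := psi_dist _ _ _ n (osc_r n) e0 (leqnn n) Nn y y' Yy Yy' yy'.
  rewrite !birkhoff_sum1 => /le_trans; apply.
  by rewrite le_eqVlt; apply/orP; left; apply/eqP; rewrite exprS; field; rewrite gt_eqF.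
Qed.

End factor_potential.

Theorem theorem1p3 (R : realType) (S S' : finPointedType) (A : rel S)
    (pi : S -> S') (phi : fullshift S -> R)
    (mu : probability (fullshift S) R) :
  let X := sft A in
  let Y := site_map pi @` X in
  let nu : probability (fullshift S') R := distribution mu (site_map pi) in
  topologically_mixing X ->
  is_gibbs X phi mu ->
  fiberwise_subpositive_mixing X pi ->
  [/\ is_bowen X phi ->
        exists psi : fullshift S' -> R, is_bowen Y psi /\ is_gibbs Y psi nu,
      is_walters X phi ->
        exists psi : fullshift S' -> R, is_walters Y psi /\ is_gibbs Y psi nu
    & is_holder X phi ->
        exists psi : fullshift S' -> R, is_holder Y psi /\ is_gibbs Y psi nu].
Proof.
move=> X Y nu _ gibbs mix.
have XT (x : fullshift S) : X x -> X (@shift S x) by exact: (@sft_iter _ A 1).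
have X0 : X !=set0 by exact: (X_neq0 gibbs).
split.
- move=> [cphi [K0 HK0]].
  have bow n : osc_on X n.+1 (birkhoff_sum n phi) `|K0|.
    case: n => [|n] x x' Xx Xx' xx'; first by rewrite !birkhoff_sum0 subrr normr0.
    apply: le_trans (ler_norm K0).
    have /var_leP H : (var X n.+1 (birkhoff_sum n.+1 phi) <= K0%:E)%E.
      by apply: le_trans HK0; apply: ereal_sup_ubound; exists n.+1.
    by apply: H => //; apply: agree_leq xx'.
  have [|psi [? ? _ _]] := factor_potential_exists gibbs mix _ bow; last by exists psi.
  by move=> e; exact: uniformly_continuous_sft.
- move=> /(is_waltersP _ X0) walt.
  have uc e : 0 < e -> exists k, osc_on X k phi e.
    move=> e0; have [k Hk] := walt e e0; exists (1 + k)%N => x x' Xx Xx' xx'.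
    by have := Hk k 1%N (leqnn k) isT x x' Xx Xx' xx'; rewrite !birkhoff_sum1.
  have [k1 Hk1] := uc _ ltr01.
  have [M [M0 phi_le]] := osc_on_bounded Hk1.
  have [k0 Hk0] := walt _ ltr01.
  have bnd n x x' : X x -> X x' ->
      `|birkhoff_sum n phi x - birkhoff_sum n phi x'| <= n%:R * (2 * M).
    move=> Xx Xx'; rewrite (le_trans (ler_normB _ _))//.
    have := birkhoff_sum_le n XT phi_le Xx; have := birkhoff_sum_le n XT phi_le Xx'.
    lra.
  (* For [n > k0] the Walters modulus bounds the first [n - k0] terms, which still have [k0] common
     letters after them; the last [k0] terms differ by at most [2 * M] each. *)
  have bow n : osc_on X n.+1 (birkhoff_sum n phi) (1 + k0%:R * (2 * M)).
    move=> x x' Xx Xx' xx'.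
    have [nk|kn] := leqP n k0.
      apply: (le_trans (bnd _ _ _ Xx Xx')); rewrite ler_wpDl// ler_wpM2r ?mulr_ge0//.
      by rewrite ler_nat.
    rewrite -(subnK (ltnW kn)) !birkhoff_sumD opprD addrACA (le_trans (ler_normD _ _))// lerD//.
      apply: (Hk0 k0 (n - k0)%N) => //; first by rewrite subn_gt0.
      by rewrite subnK ?(ltnW kn)//; apply: agree_leq xx'.
    by apply: bnd; exact: sft_iter.
  have [psi [? _ Hw _]] := factor_potential_exists gibbs mix uc bow.
  by exists psi; split=> //; exact: Hw.
- move=> [c [th [th01 Hc]]]; have /andP[th0 th1] := th01.
  have H n : osc_on X n phi (`|c| * th ^+ n).
    apply/var_leP; apply: (le_trans (Hc n)); rewrite lee_fin ler_wpM2r ?ler_norm//.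
    by rewrite exprn_ge0 ?ltW.
  have Hb j k : osc_on X (j + k) (birkhoff_sum j phi) (`|c| / (1 - th) * th ^+ k).
    exact: holder_birkhoff.
  have uc e : 0 < e -> exists k, osc_on X k phi e.
    move=> e0; have e1 : 0 < e / (`|c| + 1) by rewrite divr_gt0// ltr_wpDl.
    have [|k Hk] := @exprn_small R th _ _ e1; first by rewrite th1 ltW.
    exists k => x x' Xx Xx' xx'; apply: (le_trans (H k x x' Xx Xx' xx')).
    apply: (@le_trans _ _ (`|c| * (e / (`|c| + 1)))); first by rewrite ler_wpM2l.
    have c1 : 0 < `|c| + 1 by rewrite ltr_wpDl.
    by rewrite mulrCA ler_piMr ?(ltW e0)// ler_pdivrMr// mul1r lerDl.
  have bow n : osc_on X n.+1 (birkhoff_sum n phi) (`|c| / (1 - th)).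
    move=> x x' Xx Xx' xx'; have := Hb n 0%N x x' Xx Xx'; rewrite expr0 mulr1 addn0.
    by apply; apply: agree_leq xx'.
  have [psi [? _ _ Hh]] := factor_potential_exists gibbs mix uc bow.
  exists psi; split=> //; apply: Hh; exists (`|c| / (1 - th)), th; split=> //.
  by rewrite divr_ge0// subr_ge0 ltW.
Qed.
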